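(* Let $\lambda,\lambda_s,\mu,R,C>0$ with $\lambda+\lambda_s<\mu$ and $R\ge C/\mu$. If $q^e\in[0,1]$ is a Nash equilibrium of the dedicated customers for the mean field model in the partially observable case, then for every $\epsilon>0$ there is an $N_0$ such that for all $N>N_0$, $q^e$ is an $\epsilon$-Nash equilibrium of the dedicated customers in the finite $N$ model.
   Context: Finite $N$ model: $N$ parallel queues, each with infinite waiting space and one server with exponential service rate $\mu$. Each queue has its own dedicated Poisson arrival stream of rate $\lambda$; an additional Poisson stream of rate $N\lambda_s$ brings ''smart'' customers, who each join a shortest queue. All streams and services are independent. ''Partially observable'' means that dedicated customers do not observe the numbers of customers in the queues, while smart customers do. Smart customers always enter. A strategy of the dedicated customers is a joining probability $q\in[0,1]$; when all dedicated customers use $q$, the effective dedicated arrival rate at each queue is $\lambda q$. Let $L^N(q)$ be the stationary length of a given queue in this system. The mean sojourn time of a dedicated customer who joins is $E(W^N(q))=\frac1\mu\left(E(L^N(q))+1\right)$. Mean field model ($N\to\infty$) when dedicated customers use $q$: a single-server queue with exponential service rate $\mu$, Poisson dedicated arrivals of rate $\lambda q$, and extra (smart) arrivals that occur only when the queue is empty, at rate $\lambda_s/\pi_0$, where $\pi_0$ is the stationary probability that the queue is empty. Its stationary queue-length distribution is $\pi_0=1-\rho$, $\pi_k=\rho(1-\sigma)\sigma^{k-1}$ for $k\ge1$, with $\rho=(\lambda q+\lambda_s)/\mu$ and $\sigma=\lambda q/\mu$. The mean sojourn time of a joining dedicated customer is $E(W(q))=\sum_{k\ge0}\frac{k+1}{\mu}\pi_k$.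 Each customer receives reward $R$ after service and pays waiting cost $C$ per unit time in the system. When the dedicated customers use $q$, the expected utility of joining for a dedicated customer is $S(q)=R-C\,E(W(q))$ in the mean field model and $S^N(q)=R-C\,E(W^N(q))$ in the finite $N$ model; the utility of balking is $0$. A dedicated customer who joins with probability $r\in[0,1]$ while all other dedicated customers use $q$ thus has expected utility $r\,S(q)$, respectively $r\,S^N(q)$. A strategy $q^e\in[0,1]$ is a Nash equilibrium for the mean field model if $q^eS(q^e)\ge r\,S(q^e)$ for all $r\in[0,1]$, and an $\epsilon$-Nash equilibrium in the finite $N$ model if $q^eS^N(q^e)\ge r\,S^N(q^e)-\epsilon$ for all $r\in[0,1]$. *)

(* Defs.v *)
From HB Require Import structures.
From mathcomp Require Import all_boot all_order all_algebra.
From mathcomp Require Import all_classical all_reals all_analysis.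
From mathcomp Require Import ring.

Set Implicit Arguments.
Unset Strict Implicit.
Unset Printing Implicit Defensive.

Import Order.TTheory GRing.Theory Num.Theory.
Import numFieldNormedType.Exports.

Local Open Scope classical_set_scope.
Local Open Scope ring_scope.

(* Global balance for a continuous-time Markov chain on T with transition rates
   Q x y (x != y); all rates of the chains below are bounded. *)
Definition stationary (R : realType) (T : choiceType) (Q : T -> T -> R)
    (p : T -> R) : Prop :=
  [/\ forall x, 0 <= p x,
      (\esum_(x in [set: T]) (p x)%:E = 1)%E &
      forall x, (\esum_(y in [set~ x]) (p x * Q x y)%:E =
                 \esum_(y in [set~ x]) (p y * Q y x)%:E)%E].

Section FiniteModel.
Variables (R : realType) (lambda lambda_s mu : R) (N : nat).

Definition state := {ffun 'I_N -> nat}.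

Definition arrive (x : state) (i : 'I_N) : state :=
  [ffun j => (x j + (j == i))%N].

Definition depart (x : state) (i : 'I_N) : state :=
  [ffun j => (x j - (j == i))%N].

Definition shortest (x : state) : {set 'I_N} :=
  [set i | [forall j, (x i <= x j)%N]]%SET.

(* A smart customer picks uniformly among the shortest queues. *)
Definition smart_rate (x : state) (i : 'I_N) : R :=
  if i \in shortest x then N%:R * lambda_s / #|shortest x|%:R else 0.

Definition jsq_rate (q : R) (x y : state) : R :=
  \sum_(i < N) ((lambda * q + smart_rate x i) * (y == arrive x i)%:R
                + mu * ((0 < x i)%N && (y == depart x i))%:R).

(* The stationary distribution of the N queues.  For positive lambda_s and mu the
   chain is irreducible, so there is at most one, and for N > 0 it exists when
   lambda * q + lambda_s < mu; the default value of xget is for the other cases. *)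
Definition jsq_law (q : R) : state -> R :=
  xget (fun=> 0) [set p : state -> R | stationary (jsq_rate q) p].

Definition jsq_mean_length (q : R) (i : 'I_N) : \bar R :=
  (\esum_(x in [set: state]) (jsq_law q x * (x i)%:R)%:E)%E.

Definition jsq_mean_sojourn (q : R) (i : 'I_N) : \bar R :=
  ((mu^-1)%:E * (jsq_mean_length q i + 1))%E.

End FiniteModel.

Section MeanField.
Variables (R : realType) (lambda lambda_s mu : R).

Definition mf_rho (q : R) : R := (lambda * q + lambda_s) / mu.
Definition mf_sigma (q : R) : R := lambda * q / mu.

Definition mf_law (q : R) (k : nat) : R :=
  if k is j.+1 then mf_rho q * (1 - mf_sigma q) * mf_sigma q ^+ j
  else 1 - mf_rho q.

(* Transition rates of the mean field queue, p0 being the stationary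
   probability that it is empty. *)
Definition mf_rate (p0 q : R) (k l : nat) : R :=
  (lambda * q + (if k == 0%N then lambda_s / p0 else 0)) * (l == k.+1)%:R
  + mu * (k == l.+1)%:R.

Definition mf_mean_sojourn (q : R) : \bar R :=
  (\sum_(0 <= k <oo) (k.+1%:R / mu * mf_law q k)%:E)%E.

End MeanField.

Section Game.
Variables (R : realType) (lambda lambda_s mu reward cost : R).

Definition mf_utility (q : R) : \bar R :=
  (reward%:E - cost%:E * mf_mean_sojourn lambda lambda_s mu q)%E.

Definition jsq_utility (N : nat) (q : R) (i : 'I_N) : \bar R :=
  (reward%:E - cost%:E * jsq_mean_sojourn lambda lambda_s mu q i)%E.

Definition mf_nash (q : R) : Prop :=
  0 <= q <= 1 /\
  forall r : R, 0 <= r <= 1 ->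
    (r%:E * mf_utility q <= q%:E * mf_utility q)%E.

(* Required of the dedicated customers of every queue i. *)
Definition jsq_eps_nash (N : nat) (eps q : R) : Prop :=
  0 <= q <= 1 /\
  forall (i : 'I_N) (r : R), 0 <= r <= 1 ->
    (r%:E * jsq_utility q i - eps%:E <= q%:E * jsq_utility q i)%E.

End Game.

(* mf_law is the stationary distribution of the mean field queue. *)
Lemma mf_law_stationary (R : realType) (lambda lambda_s mu q : R) :
  0 < lambda -> 0 < lambda_s -> lambda + lambda_s < mu -> 0 <= q <= 1 ->
  stationary (mf_rate lambda lambda_s mu (mf_law lambda lambda_s mu q 0) q)
             (mf_law lambda lambda_s mu q).
Proof.
move=> l0 ls0 lmu /andP[q0 q1].
have mu0 : 0 < mu by apply: lt_trans lmu; rewrite addr_gt0.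
have lq0 : 0 <= lambda * q by rewrite mulr_ge0 // ltW.
have lql : lambda * q <= lambda by rewrite ler_piMr // ltW.
set p := mf_law _ _ _ q; set rho := mf_rho lambda lambda_s mu q.
set sigma := mf_sigma lambda mu q.
have rho0 : 0 < rho by rewrite divr_gt0 // ltr_wpDl.
have rho1 : rho < 1.
  by rewrite ltr_pdivrMr // mul1r; apply: le_lt_trans lmu; rewrite lerD2r.
have sigma0 : 0 <= sigma by rewrite divr_ge0 // ltW.
have sigma1 : sigma < 1.
  apply: le_lt_trans rho1; rewrite ler_pM2r ?invr_gt0 // lerDl; exact: ltW.
have p0E : p 0%N = 1 - rho by [].
have pSE k : p k.+1 = rho * (1 - sigma) * sigma ^+ k by [].
have p_ge0 k : 0 <= p k.
  case: k => [|k]; first by rewrite p0E subr_ge0 ltW.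
  rewrite pSE mulr_ge0 ?exprn_ge0 // mulr_ge0 ?subr_ge0 ?ltW //.
have p0_gt0 : 0 < p 0%N by rewrite p0E subr_gt0.
have cut k : p k * mf_rate lambda lambda_s mu (p 0%N) q k k.+1 =
             p k.+1 * mf_rate lambda lambda_s mu (p 0%N) q k.+1 k.
  rewrite /mf_rate !eqxx (ltn_eqF (ltnW (ltnSn k.+1))).
  rewrite !mulr1 !mulr0 addr0 add0r; case: k => [|k] /=.
    rewrite expr0 mulr1 mulrDr [_ * (_ / _)]mulrC divfK ?gt_eqF //.
    rewrite /rho /mf_rho /mf_sigma; field; exact: lt0r_neq0.
  rewrite addr0 exprS /mf_sigma; field; exact: lt0r_neq0.
have rate0 k l : l != k.+1 -> k != l.+1 ->
    mf_rate lambda lambda_s mu (p 0%N) q k l = 0.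
  by move=> /negPf lk /negPf kl; rewrite /mf_rate lk kl !mulr0 addr0.
split => //.
- rewrite -nneseries_esumT; last by move=> k; rewrite lee_fin.
  apply/cvg_lim => //; rewrite -(cvg_shiftS _).
  have -> : [sequence (\sum_(0 <= k < n.+1) (p k)%:E)%E]_n =
            EFin \o (fun n => 1 - rho * sigma ^+ n).
    apply/funext => n /=; rewrite sumEFin; congr EFin.
    elim: n => [|n IH]; first by rewrite big_nat1 p0E expr0 mulr1.
    by rewrite big_nat_recr // IH pSE exprS /=; ring.
  apply: cvg_EFin; first exact: nearW.
  rewrite -[X in _ --> X]subr0; apply: cvgB; first exact: cvg_cst.
  by apply: cvg_geometric; rewrite ger0_norm.
- move=> x.
  have d y : p x * mf_rate lambda lambda_s mu (p 0%N) q x y =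
             p y * mf_rate lambda lambda_s mu (p 0%N) q y x.
    have [->|yx] := eqVneq y x.+1; first exact: cut.
    have [->|xy] := eqVneq x y.+1; first by rewrite -cut.
    by rewrite !rate0 ?mulr0.
  by apply: eq_esum => y _; rewrite d.
Qed.

(* Main.v *)
Require Import Defs.
From HB Require Import structures.
From mathcomp Require Import all_boot all_order all_algebra.
From mathcomp Require Import finmap.
From mathcomp Require Import all_classical all_reals all_analysis.
From mathcomp Require Import ring lra perm.

Import Order.TTheory GRing.Theory Num.Theory.
Import numFieldNormedType.Exports.
Local Open Scope ring_scope.

Set Implicit Arguments.
Unset Strict Implicit.
Unset Printing Implicit Defensive.

(** The other customers enter the utility of a dedicated customer only through
    the mean length of a queue.  Let L = rho / (1 - sigma) be this mean in the
    mean field model and l_N the one in the system of N queues.  Then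
    S^N = S - (cost / mu) (l_N - L), so that for 0 <= l_N - L the gain
    (r - q) S^N from a deviation exceeds (r - q) S, which is at most 0 at a mean
    field equilibrium, by at most (cost / mu) (l_N - L).  What has to be shown
    is 0 <= l_N - L --> 0 ([jsq_mean_length_bounds]).

    In the stationary system let v_k be the probability that a given queue has
    at least k customers and t_k the probability that all queues do.  A smart
    customer raises a queue from k to k + 1 exactly when the minimal length is
    k, so balancing the flow through this level and summing over the levels
    above it gives mu v_(k+1) = lambda q v_k + lambda_s t_k ([tail_balance]).
    - As t_k >= 0 and t_0 = 1, v_(k+1) >= rho sigma^k, and l_N, the sum of the
      v_(k+1), is at least L.
    - The sum over k shows that l_N - L is a multiple of t_1 + t_2 + ..., the
      mean of the minimal length.  As t_k <= v_k, the recursion also gives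
      t_k <= v_k <= rho^k, a bound that does not depend on N; hence it is
      enough that t_1, the probability that no server is idle, tends to 0.
    - The last fact is [min_tail_bound], of order 1 / N.  Let d_k be the fraction
      of queues with at least k customers minus its mean field value, and let h
      be the function that is 0 on negative numbers, d^2 / 2 up to 1 - rho, and
      affine from there on.  The drift of the sum of the h(d_k) is at most
      - mu h(d_1) + O(1 / N) ([gen_potential]): convexity of h makes the birth
      and death terms telescope, and when no queue is empty, d_1 is equal to
      1 - rho, where the slope of h is maximal, so that the smart customers,
      who are then directed to a higher level than in the mean field, do not
      increase the sum.  The mean drift is 0, which bounds the mean of h(d_1)
      and thereby the probability of d_1 = 1 - rho.

    The stationary law is obtained as a functional on bounded functions, namely
    a limit along an ultrafilter of time averages of the uniformized chain
    started from the empty system ([invariant_mean_exists]).  Its value on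
    generators is 0, it is invariant under permutations of the queues since the
    initial state is, and the sum of the squared lengths is a Lyapunov function
    that prevents escape of mass, so that the functional is integration against
    a stationary law ([esum_law], [law_stationary]).  As every state leads to
    the empty one, there is no other stationary law ([stationary_unique]), and
    the one in the statement is this one ([jsq_lawE]).  The estimates above are
    therefore carried out with the functional and finite sums. *)

(** * Configurations and the generator *)

Section Configurations.
Variables (R : realType) (N : nat).
Hypothesis N_gt0 : (0 < N)%N.
Implicit Types (x : state N) (i : 'I_N).

Lemma arriveE x i j : arrive x i j = (x j + (j == i))%N.
Proof. by rewrite ffunE. Qed.

Lemma departE x i j : depart x i j = (x j - (j == i))%N.
Proof. by rewrite ffunE. Qed.

Lemma depart0 x i : x i = 0%N -> depart x i = x.
Proof.
move=> xi; apply/ffunP => j; rewrite departE.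
by case: eqP => [->|]; rewrite ?xi ?subn0.
Qed.

Lemma arrive_neq x i : arrive x i != x.
Proof.
apply/eqP => /ffunP/(_ i); rewrite arriveE eqxx addn1 => /eqP.
by rewrite eqn_leq ltnn.
Qed.

Lemma depart_neq x i : (0 < x i)%N -> depart x i != x.
Proof.
move=> xi; apply/eqP => /ffunP/(_ i); rewrite departE eqxx subn1 => /eqP.
by case: (x i) xi => //= n _; rewrite ltn_eqF.
Qed.

Lemma shortestP x i : reflect (forall j, (x i <= x j)%N) (i \in shortest x).
Proof. by rewrite inE; exact: forallP. Qed.

(** Equal to 0 only as a default when there are no queues. *)
Definition minlen x : nat :=
  if [pick i in shortest x] is Some i then x i else 0.

Lemma shortest_gt0 x : (0 < #|shortest x|)%N.
Proof.
apply/card_gt0P; pose i0 := Ordinal N_gt0.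
exists [arg min_(i < i0) x i]; apply/shortestP => j.
by case: arg_minnP => // i _; apply.
Qed.

Lemma minlen_shortest x i : i \in shortest x -> x i = minlen x.
Proof.
move=> /shortestP si; rewrite /minlen; case: pickP => [j /shortestP sj|].
  by apply/anti_leq; rewrite si sj.
by move=> /(_ i) /negP; case; apply/shortestP.
Qed.

Lemma minlen_exists x : exists i, x i = minlen x.
Proof.
have /card_gt0P[i si] := shortest_gt0 x.
by exists i; exact: minlen_shortest.
Qed.

Lemma leq_minlen x k : (k <= minlen x)%N = [forall i, k <= x i]%N.
Proof.
apply/idP/forallP => [km i|]; last by have [i <-] := minlen_exists x; exact.
have /card_gt0P[j sj] := shortest_gt0 x.
by apply: leq_trans km _; rewrite -(minlen_shortest sj); exact/shortestP.
Qed.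

Lemma minlen_le x i : (minlen x <= x i)%N.
Proof. by have := leqnn (minlen x); rewrite leq_minlen => /forallP. Qed.

Section Smart.
Variable lambda_s : R.
Hypothesis lambda_s_ge0 : 0 <= lambda_s.
Local Notation smart := (smart_rate lambda_s).

Lemma smart_rate_ge0 x i : 0 <= smart x i.
Proof. by rewrite /smart_rate; case: ifP => // _; rewrite divr_ge0 ?mulr_ge0. Qed.

(** Smart customers see a queue of minimal length, whichever one they pick. *)
Lemma sum_smart_rate x (psi : nat -> R) :
  \sum_(i < N) smart x i * psi (x i) = N%:R * lambda_s * psi (minlen x).
Proof.
transitivity (\sum_(i in shortest x)
   (N%:R * lambda_s / #|shortest x|%:R * psi (minlen x))).
  rewrite [RHS]big_mkcond; apply: eq_bigr => i _; rewrite /smart_rate.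
  by case: ifPn => [si|_]; rewrite ?mul0r // minlen_shortest.
rewrite sumr_const -[LHS]mulr_natr mulrAC divfK // pnatr_eq0 -lt0n.
exact: shortest_gt0.
Qed.

Lemma sum_smart_rate1 x : \sum_(i < N) smart x i = N%:R * lambda_s.
Proof.
rewrite -[RHS]mulr1 -(sum_smart_rate x (fun=> 1)).
by apply: eq_bigr => i _; rewrite mulr1.
Qed.

End Smart.

Definition permute (s : 'S_N) x : state N := [ffun i => x (s i)].

Lemma arrive_permute s x i : arrive (permute s x) i = permute s (arrive x (s i)).
Proof. by apply/ffunP => j; rewrite !ffunE (inj_eq perm_inj). Qed.

Lemma depart_permute s x i : depart (permute s x) i = permute s (depart x (s i)).
Proof. by apply/ffunP => j; rewrite !ffunE (inj_eq perm_inj). Qed.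

Lemma mem_shortest_permute s x i :
  (i \in shortest (permute s x)) = (s i \in shortest x).
Proof.
apply/shortestP/shortestP => H j; last by rewrite !ffunE; apply: H.
by have := H (s^-1 j)%g; rewrite !ffunE permKV.
Qed.

Lemma smart_rate_permute (lambda_s : R) s x i :
  smart_rate lambda_s (permute s x) i = smart_rate lambda_s x (s i).
Proof.
rewrite /smart_rate mem_shortest_permute; congr (if _ then _ / _%:R else _).
rewrite -[LHS](card_imset _ (@perm_inj _ s)); apply: eq_card => j.
apply/imsetP/idP => [[k ks ->]|js]; first by rewrite -mem_shortest_permute.
by exists (s^-1 j)%g; rewrite ?permKV // mem_shortest_permute permKV.
Qed.

End Configurations.

Section Generator.
Variables (R : realType) (N : nat) (beta lambda_s mu : R).
Hypothesis N_gt0 : (0 < N)%N.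
Hypotheses (beta_ge0 : 0 <= beta) (lambda_s_gt0 : 0 < lambda_s) (mu_gt0 : 0 < mu).
Implicit Types (x : state N) (i : 'I_N) (f g : state N -> R).

Local Notation smart := (@smart_rate R lambda_s N).

(** A service completion at an empty queue is counted as a jump from [x] to
    itself; this makes the total jump rate the same in all states. *)
Definition gen f x : R := \sum_(i < N)
  ((beta + smart x i) * (f (arrive x i) - f x) + mu * (f (depart x i) - f x)).

Definition clock : R := N%:R * (beta + lambda_s + mu).

(** One step of the chain observed at the epochs of a Poisson process of rate
    [clock], acting on functions. *)
Definition step f x : R := clock^-1 * \sum_(i < N)
  ((beta + smart x i) * f (arrive x i) + mu * f (depart x i)).

Let ls_ge0 := ltW lambda_s_gt0.

Lemma clock_gt0 : 0 < clock.
Proof. by rewrite mulr_gt0 ?ltr0n // -addrA ltr_wpDl // addr_gt0. Qed.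

Lemma sum_rates x : \sum_(i < N) (beta + smart x i + mu) = clock.
Proof.
rewrite !big_split /= sum_smart_rate1 // !sumr_const card_ord /clock.
by rewrite !mulrDr !mulr_natl.
Qed.

Lemma gen_step f x : gen f x = clock * (step f x - f x).
Proof.
rewrite mulrBr mulVKf ?gt_eqF ?clock_gt0 // -{1}(sum_rates x) mulr_suml -sumrB.
by apply: eq_bigr => i _; ring.
Qed.

Lemma step_ge0 f : (forall x, 0 <= f x) -> forall x, 0 <= step f x.
Proof.
move=> f0 x; apply: mulr_ge0; first by rewrite invr_ge0 ltW // clock_gt0.
apply: sumr_ge0 => i _.
by rewrite addr_ge0 // mulr_ge0 ?addr_ge0 ?smart_rate_ge0 // ltW.
Qed.

Lemma stepD f g x : step (f \+ g) x = step f x + step g x.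
Proof.
rewrite -mulrDr -big_split; congr (_ * _); apply: eq_bigr => i _ /=; ring.
Qed.

Lemma stepZ c f x : step (fun x => c * f x) x = c * step f x.
Proof.
rewrite mulrCA mulr_sumr; congr (_ * _); apply: eq_bigr => i _ /=; ring.
Qed.

Lemma step_cst c x : step (fun=> c) x = c.
Proof.
rewrite /step; apply: (@mulfI _ clock); first by rewrite gt_eqF ?clock_gt0.
rewrite mulVKf ?gt_eqF ?clock_gt0 // -(sum_rates x) mulr_suml.
by apply: eq_bigr => i _; rewrite -mulrDl.
Qed.

Lemma step_permute s f x : step (f \o permute s) x = step f (permute s x).
Proof.
rewrite /step [in RHS](reindex_inj (@perm_inj _ s^-1%g)) /=; congr (_ * _).
by apply: eq_bigr => i _; rewrite arrive_permute depart_permute smart_rate_permute permKV.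
Qed.

Definition origin : state N := [ffun=> 0%N].

(** The law of the uniformized chain after n steps from the empty system,
    seen as a functional. *)
Definition walk n f : R := iter n step f origin.

Lemma walkS n f : walk n.+1 f = walk n (step f).
Proof. by rewrite /walk iterSr. Qed.

Lemma walkD n f g : walk n (f \+ g) = walk n f + walk n g.
Proof.
elim: n f g => [|n IH] f g //; rewrite !walkS -IH.
by congr walk; apply/funext => x; exact: stepD.
Qed.

Lemma walkZ n c f : walk n (fun x => c * f x) = c * walk n f.
Proof.
elim: n f => [|n IH] f //; rewrite !walkS -IH.
by congr walk; apply/funext => x; exact: stepZ.
Qed.

Lemma walk_cst n c : walk n (fun=> c) = c.
Proof.
elim: n => [|n IH] //; rewrite walkS -[RHS]IH.
by congr walk; apply/funext => x; exact: step_cst.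
Qed.

Lemma walk_ge0 n f : (forall x, 0 <= f x) -> 0 <= walk n f.
Proof.
elim: n f => [|n IH] f f0; first exact: f0.
by rewrite walkS; apply: IH => x; exact: step_ge0.
Qed.

Lemma walk_le n f g : (forall x, f x <= g x) -> walk n f <= walk n g.
Proof.
move=> fg; rewrite -subr_ge0 -mulN1r -walkZ -walkD.
by apply: walk_ge0 => x /=; rewrite mulN1r subr_ge0.
Qed.

Lemma walk_permute s n f : walk n (f \o permute s) = walk n f.
Proof.
elim: n f => [|n IH] f.
  by rewrite /walk /=; congr f; apply/ffunP => i; rewrite !ffunE.
rewrite !walkS -[RHS]IH; congr walk; apply/funext => x; exact: step_permute.
Qed.

Definition cesaro f n : R := n.+1%:R^-1 * \sum_(j < n.+1) walk j f.

Lemma cesaroD f g n : cesaro (f \+ g) n = cesaro f n + cesaro g n.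
Proof.
by rewrite -mulrDr -big_split; congr (_ * _); apply: eq_bigr => j _; rewrite walkD.
Qed.

Lemma cesaroZ c f n : cesaro (fun x => c * f x) n = c * cesaro f n.
Proof.
by rewrite mulrCA mulr_sumr; congr (_ * _); apply: eq_bigr => j _; rewrite walkZ.
Qed.

Lemma cesaro_le f g n : (forall x, f x <= g x) -> cesaro f n <= cesaro g n.
Proof.
move=> fg; rewrite ler_pM2l ?invr_gt0 //; apply: ler_sum => j _; exact: walk_le.
Qed.

Lemma cesaro_cst c n : cesaro (fun=> c) n = c.
Proof.
rewrite /cesaro (eq_bigr (fun=> c)) => [|j _]; last exact: walk_cst.
by rewrite sumr_const card_ord -[c *+ _]mulr_natl mulKf.
Qed.

Lemma cesaro_permute s f n : cesaro (f \o permute s) n = cesaro f n.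
Proof. by congr (_ * _); apply: eq_bigr => j _; rewrite walk_permute. Qed.

Lemma cesaro_gen f n :
  cesaro (gen f) n = n.+1%:R^-1 * (clock * (walk n.+1 f - f origin)).
Proof.
congr (_ * _); rewrite -[f origin]/(walk 0 f).
rewrite -(telescope_sumr (fun j => walk j f)) // mulr_sumr big_mkord.
apply: eq_bigr => j _; rewrite walkS.
have -> : gen f = (fun x => clock * (step f x + (-1) * f x)).
  by apply/funext => x; rewrite gen_step mulN1r.
by rewrite walkZ (walkD j (step f)) (walkZ j (-1)) mulN1r.
Qed.

Definition bounded f := exists M : R, forall x, `|f x| <= M.

Lemma cesaro_bounded f : bounded f -> exists M : R, forall n, `|cesaro f n| <= M.
Proof.
move=> [M fM]; exists M => n; rewrite ler_norml.
rewrite -[X in X <= _ <= _](cesaro_cst _ n) -[X in _ <= _ <= X](cesaro_cst _ n).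
by rewrite !cesaro_le // => x; have := fM x; rewrite ler_norml => /andP[].
Qed.

End Generator.

(** * Bounded functions and a stationary mean *)

Section BoundedFunctions.
Variables (R : realType) (N : nat).
Implicit Types (f g : state N -> R).

Lemma bounded_cst c : bounded (fun _ : state N => c : R).
Proof. by exists `|c|. Qed.

Lemma boundedD f g : bounded f -> bounded g -> bounded (f \+ g).
Proof.
move=> [M fM] [K gK]; exists (M + K) => x.
by apply: le_trans (ler_normD _ _) _; apply: lerD.
Qed.

Lemma boundedM f g :
  bounded f -> bounded g -> bounded (fun x => f x * g x).
Proof.
by move=> [M fM] [K gK]; exists (M * K) => x; rewrite normrM ler_pM.
Qed.

Lemma boundedZ c f : bounded f -> bounded (fun x => c * f x).
Proof. exact: boundedM (bounded_cst c). Qed.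

Lemma bounded_indic (b : state N -> bool) : bounded (fun x => (b x)%:R : R).
Proof. by exists 1 => x; case: (b x); rewrite ?normr1 ?normr0. Qed.

Lemma bounded_sum (I : Type) (r : seq I) (P : pred I) (F : I -> state N -> R) :
  (forall i, bounded (F i)) ->
  bounded (fun x => \sum_(i <- r | P i) F i x).
Proof.
move=> bF; elim: r => [|i r IH].
  by exists 0 => x; rewrite big_nil normr0.
case Pi: (P i).
  have [M HM] := boundedD (bF i) IH.
  by exists M => x; rewrite big_cons Pi; exact: HM.
by have [M HM] := IH; exists M => x; rewrite big_cons Pi; exact: HM.
Qed.

Lemma bounded_comp f (T : state N -> state N) :
  bounded f -> bounded (f \o T).
Proof. by move=> [M fM]; exists M => x; exact: fM. Qed.

Lemma bounded_smart (lambda_s : R) i : (0 < N)%N -> 0 <= lambda_s ->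
  bounded (fun x : state N => smart_rate lambda_s x i).
Proof.
move=> N0 ls0; exists (N%:R * lambda_s) => x.
rewrite ger0_norm ?smart_rate_ge0 // -(sum_smart_rate1 N0 lambda_s x) (bigD1 i) //=.
by rewrite lerDl sumr_ge0 // => j _; exact: smart_rate_ge0.
Qed.

End BoundedFunctions.

#[local] Hint Resolve bounded_cst bounded_indic : core.

Section InvariantMean.
Variables (R : realType) (N : nat) (beta lambda_s mu : R).
Hypothesis N_gt0 : (0 < N)%N.
Hypotheses (beta_ge0 : 0 <= beta) (lambda_s_gt0 : 0 < lambda_s) (mu_gt0 : 0 < mu).
Hypothesis stable : beta + lambda_s < mu.
Implicit Types (x : state N) (i : 'I_N) (f g : state N -> R).

Local Notation smart := (@smart_rate R lambda_s N).
Local Notation gen := (@gen R N beta lambda_s mu).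
Local Notation clock := (clock N beta lambda_s mu).
Local Notation step := (@step R N beta lambda_s mu).
Local Notation walk := (@walk R N beta lambda_s mu).
Local Notation cesaro := (@cesaro R N beta lambda_s mu).

Let ls_ge0 := ltW lambda_s_gt0.
Let clock_gt0' := clock_gt0 N_gt0 beta_ge0 lambda_s_gt0 mu_gt0.

Lemma bounded_gen f : bounded f -> bounded (gen f).
Proof.
move=> bf; apply: bounded_sum => i; apply: boundedD.
  apply: boundedM.
    by apply: boundedD => //; exact: bounded_smart.
  apply: boundedD; first exact: (bounded_comp (fun x => arrive x i)).
  have [M fM] := bf; by exists M => x; rewrite normrN.
apply: boundedZ; apply: boundedD.
  exact: (bounded_comp (fun x => depart x i)).
have [M fM] := bf; by exists M => x; rewrite normrN.
Qed.

Lemma gen_separable (h : nat -> R) x :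
  gen (fun x => \sum_(j < N) h (x j)) x =
  \sum_(i < N) ((beta + smart x i) * (h (x i).+1 - h (x i)) +
                mu * (h (x i).-1 - h (x i))).
Proof.
apply: eq_bigr => i _; congr (_ * _ + _ * _); rewrite -sumrB (bigD1 i) //=.
  rewrite arriveE eqxx addn1 big1 ?addr0 // => j /negPf ji.
  by rewrite arriveE ji addn0 subrr.
rewrite departE eqxx subn1 big1 ?addr0 // => j /negPf ji.
by rewrite departE ji subn0 subrr.
Qed.

Definition total_length x : nat := \sum_(i < N) x i.

Definition energy x : R := \sum_(i < N) (x i)%:R ^+ 2.

(** Smart customers join the minimum, so in the drift of the sum of squares
    they do no worse than customers joining a uniformly chosen queue. *)
Lemma gen_energy x :
  gen energy x <= clock - 2 * (mu - beta - lambda_s) * (total_length x)%:R.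
Proof.
rewrite (gen_separable (fun n => n%:R ^+ 2)).
have minS : N%:R * lambda_s * (minlen x)%:R <= lambda_s * (total_length x)%:R.
  rewrite mulrAC mulrC ler_wpM2l // -natrM ler_nat /total_length.
  rewrite -{1}(card_ord N) -sum_nat_const leq_sum // => i _; exact: minlen_le.
apply: (@le_trans _ _ (\sum_(i < N) (beta + smart x i + mu +
     2 * (smart x i * (x i)%:R) - 2 * (mu - beta) * (x i)%:R))).
  apply: ler_sum => i _.
  have -> : (beta + smart x i) * ((x i).+1%:R ^+ 2 - (x i)%:R ^+ 2) =
            (beta + smart x i) * (2 * (x i)%:R + 1) by rewrite -natr1; ring.
  have : mu * ((x i).-1%:R ^+ 2 - (x i)%:R ^+ 2) <= mu * (1 - 2 * (x i)%:R).
    rewrite ler_pM2l //; case: (x i) => [|n] /=; first by lra.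
    by rewrite -natr1; lra.
  lra.
rewrite sumrB big_split /= sum_rates // -!mulr_sumr.
rewrite (sum_smart_rate N_gt0 lambda_s x (fun n => n%:R)) -natr_sum -/(total_length x).
lra.
Qed.

(** The mean drift of [energy] cannot stay negative, as [energy] is at least 0;
    this bounds the time average of the total length. *)
Lemma cesaro_total n :
  cesaro (fun x => (total_length x)%:R) n <= clock / (2 * (mu - beta - lambda_s)).
Proof.
have c0 : 0 < 2 * (mu - beta - lambda_s) by rewrite mulr_gt0 // -addrA -opprD subr_gt0.
have e0 x : 0 <= energy x by apply: sumr_ge0 => i _; exact: exprn_ge0.
rewrite ler_pdivlMr // mulrC -cesaroZ.
have : 0 <= cesaro (gen energy) n.
  rewrite cesaro_gen // mulr_ge0 ?invr_ge0 // mulr_ge0 ?(ltW clock_gt0') //.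
  have -> : energy (origin N) = 0 by apply: big1 => i _; rewrite ffunE expr0n.
  by rewrite subr0; exact: walk_ge0.
move=> /le_trans -/(_ _ (cesaro_le _ _ _ _ _ gen_energy)).
have -> : (fun x => clock - 2 * (mu - beta - lambda_s) * (total_length x)%:R) =
          (fun=> clock) \+ (fun x => (-1) *
             (2 * (mu - beta - lambda_s) * (total_length x)%:R)).
  by apply/funext => x /=; rewrite mulN1r.
by rewrite cesaroD cesaro_cst // (cesaroZ _ _ _ (-1)) mulN1r subr_ge0; apply.
Qed.

(** A finitely additive expectation that behaves as the one under a symmetric
    stationary law; the last clause says that no mass escapes to infinity. *)
Record invariant_mean (A : (state N -> R) -> R) : Prop := InvariantMean {
  meanD : forall f g, bounded f -> bounded g ->
    A (f \+ g) = A f + A g;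
  meanZ : forall c f, bounded f -> A (fun x => c * f x) = c * A f;
  mean_le : forall f g, bounded f -> bounded g ->
    (forall x, f x <= g x) -> A f <= A g;
  mean1 : A (fun=> 1) = 1;
  mean_gen : forall f, bounded f -> A (gen f) = 0;
  mean_permute : forall s f, bounded f -> A (f \o permute s) = A f;
  mean_tight : forall eps, 0 < eps -> exists k,
    A (fun x => (k <= total_length x)%N%:R) <= eps }.

(** Along an ultrafilter the time averages of all bounded functions converge at
    once.  The average of a generator telescopes, hence tends to 0. *)
Lemma invariant_mean_exists : exists A, invariant_mean A.
Proof.
have [U [UU Uoo]] := ultraFilterLemma (@eventually_filter).
pose A f : R := lim (cesaro f @ U)%classic.
have cvgA f : bounded f -> (cesaro f @ U --> A f)%classic.
  move=> /(cesaro_bounded N_gt0 beta_ge0 lambda_s_gt0 mu_gt0)[M fM].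
  have Uf : ProperFilter (cesaro f @ U)%classic by exact: fmap_proper_filter.
  have [|l [_ cl]] := @segment_compact R (- M) M _ Uf.
    by apply: (@filterE _ U) => n /=; rewrite in_itv /= -ler_norml; exact: fM.
  suff fl : (cesaro f @ U --> l)%classic by rewrite (_ : A f = l) //; exact/cvg_lim.
  move=> B Bl.
  have [//|UnB] := in_ultra_setVsetC (cesaro f @^-1` B)%classic UU.
  by have [y []] := cl (~` B)%classic B UnB Bl.
have limA f l : (cesaro f @ \oo --> l)%classic -> A f = l.
  move=> fl; apply/cvg_lim => //; exact: cvg_trans (cvg_app _ Uoo) fl.
exists A; split.
- move=> f g bf bg; apply/cvg_lim => //.
  have -> : cesaro (f \+ g) = (fun n => cesaro f n + cesaro g n).
    by apply/funext => n; exact: cesaroD.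
  by apply: cvgD; exact: cvgA.
- move=> c f bf; apply/cvg_lim => //.
  have -> : cesaro (fun x => c * f x) = (fun n => c * cesaro f n).
    by apply/funext => n; exact: cesaroZ.
  by apply: cvgMr; exact: cvgA.
- move=> f g bf bg fg.
  apply: (ler_cvg_to (cvgA f bf) (cvgA g bg)).
  by apply: filterE => n; exact: cesaro_le.
- apply: limA; rewrite (_ : cesaro _ = (fun=> 1)); first exact: cvg_cst.
  by apply/funext => n; exact: cesaro_cst.
- move=> f bf; apply: limA.
  have [M fM] : exists M : R, forall n, `|walk n f| <= M.
    have [M fM] := bf; exists M => n.
    rewrite ler_norml -[X in X <= _ <= _](walk_cst N_gt0 beta_ge0 lambda_s_gt0 mu_gt0 n).
    rewrite -[X in _ <= _ <= X](walk_cst N_gt0 beta_ge0 lambda_s_gt0 mu_gt0 n).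
    by rewrite !walk_le // => x; have := fM x; rewrite ler_norml => /andP[].
  apply/norm_cvg0P; apply: (@squeeze_cvgr _ _ _ _ (fun=> 0)
    (fun n => n.+1%:R^-1 * (clock * (2 * M)))).
  + apply: nearW => n; rewrite normr_ge0 cesaro_gen // normrM ger0_norm //.
    rewrite ler_pM2l ?invr_gt0 // normrM gtr0_norm // ler_pM2l //.
    apply: le_trans (ler_normB _ _) _; have := fM n.+1; have := fM 0%N.
    by rewrite -[walk 0 f]/(f (origin N)); lra.
  + exact: cvg_cst.
  + rewrite -[X in (_ --> X)%classic](mul0r (clock * (2 * M))).
    by apply: cvgMl; exact: cvg_harmonic.
- move=> s f bf; rewrite /A (_ : cesaro (f \o permute s) = cesaro f) //.
  by apply/funext => n; exact: cesaro_permute.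
- move=> eps eps0; set B := clock / (2 * (mu - beta - lambda_s)).
  have B0 : 0 < B by rewrite divr_gt0 // mulr_gt0 // -addrA -opprD subr_gt0.
  exists (Num.trunc (B / eps)).+1; set k := _.+1.
  apply: limr_le; first by apply/cvg_ex; eexists; exact: cvgA.
  apply: filterE => n.
  have kB : B <= k%:R * eps by rewrite -ler_pdivrMr // ltW // truncnS_gt.
  rewrite -(@ler_pM2l _ k%:R) ?ltr0n //.
  apply: le_trans kB; apply: le_trans (cesaro_total n); rewrite -cesaroZ.
  apply: cesaro_le => // x; rewrite -natrM ler_nat.
  by case: leqP => // kx; rewrite ?muln1 ?muln0.
Qed.

Section MeanTheory.
Variable A : (state N -> R) -> R.
Hypothesis mA : invariant_mean A.

Lemma mean0 : A (fun=> 0) = 0.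
Proof.
rewrite -[RHS](mul0r (A (fun=> 1))) -(meanZ mA) //.
by congr A; apply/funext => x; rewrite mul0r.
Qed.

Lemma mean_cst c : A (fun=> c) = c.
Proof.
rewrite -[RHS]mulr1 -[in RHS](mean1 mA) -(meanZ mA) //.
by congr A; apply/funext => x; rewrite mulr1.
Qed.

Lemma mean_ge0 f : bounded f -> (forall x, 0 <= f x) -> 0 <= A f.
Proof. by move=> bf f0; rewrite -mean0; apply: (mean_le mA). Qed.

Lemma mean_sum (I : Type) (r : seq I) (F : I -> state N -> R) :
  (forall k, bounded (F k)) ->
  A (fun x => \sum_(k <- r) F k x) = \sum_(k <- r) A (F k).
Proof.
move=> bF; elim: r => [|k r IH].
  rewrite big_nil -[RHS]mean0; congr A.
  by apply/funext => x; rewrite big_nil.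
rewrite big_cons -IH -(meanD mA) //; last exact: bounded_sum.
by congr A; apply/funext => x; rewrite big_cons.
Qed.

End MeanTheory.
End InvariantMean.

(** * Uniqueness of stationary laws *)

Section Sums.
Local Open Scope classical_set_scope.
Variables (R : realType) (T : choiceType).
Implicit Types (f g : T -> \bar R).

Lemma esum_setC1 f x : f x = 0%E ->
  (\esum_(y in [set~ x]) f y = \esum_(y in [set: T]) f y)%E.
Proof.
move=> fx; rewrite esum_mkcond; apply: eq_esum => y _; case: ifPn => //.
by rewrite in_setC negbK inE => /= ->.
Qed.

Lemma esum_delta (c : T -> R) z : 0 <= c z ->
  (\esum_(y in [set: T]) (c y * (y == z)%:R)%:E = (c z)%:E)%E.
Proof.
move=> cz; rewrite -(@esum_set1 R T z (fun y => (c y)%:E)) ?lee_fin //.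
rewrite [RHS]esum_mkcond; apply: eq_esum => y _; case: eqP => yz.
  by rewrite mem_set // mulr1.
by rewrite memNset // mulr0.
Qed.

Lemma esum_swap (a : T -> T -> \bar R) : (forall x y, 0 <= a x y)%E ->
  (\esum_(x in [set: T]) \esum_(y in [set: T]) a x y =
   \esum_(y in [set: T]) \esum_(x in [set: T]) a x y)%E.
Proof.
move=> a0; rewrite !esum_esum //.
rewrite (reindex_esum ([set: T] `*`` fun=> [set: T]) _ (fun z => (z.2, z.1))) //.
by split=> // [[x1 y1] [x2 y2] _ _ [-> ->] //|[x y] _]; exists (y, x).
Qed.

Lemma esum_ge1 f x : (forall y, 0 <= f y)%E ->
  (f x <= \esum_(y in [set: T]) f y)%E.
Proof.
move=> f0; apply: esum_ge; exists [set x]; last by rewrite fsbig_set1.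
by split; [exact: finite_set1|].
Qed.

Lemma esum_le_eq f g :
  (forall x, 0 <= f x <= g x)%E ->
  (\esum_(x in [set: T]) g x = \esum_(x in [set: T]) f x)%E ->
  (\esum_(x in [set: T]) f x < +oo)%E -> f = g.
Proof.
move=> fg gf foo; apply/funext => x; apply/eqP; rewrite eq_le.
have f0 y : (0 <= f y)%E by have /andP[] := fg y.
have g0 y : (0 <= g y)%E by apply: le_trans (f0 y) _; have /andP[] := fg y.
have [_ ->] := andP (fg x); rewrite andTb.
move: gf foo; rewrite (esumID [set x] setT) // (esumID [set x] setT f) //.
rewrite !setTI !esum_set1 //; set F := (\esum_(y in ~` _) f y)%E.
have F0 : (0 <= F)%E by apply: esum_ge0.
have FG : (F <= \esum_(y in [set~ x]) g y)%E.
  by apply: le_esum => y _; have /andP[] := fg y.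
move=> gf foo; have Ff : F \is a fin_num.
  by rewrite ge0_fin_numE //; apply: le_lt_trans foo; rewrite leeDr.
by rewrite -(leeD2rE _ _ Ff) -gf leeD2l.
Qed.

End Sums.

(** Uniqueness of the stationary law of a chain with bounded rates all of
    whose states lead to [o].  With d the positive part of p - p', the measure d
    receives at every state at least as much flow as it sends out, and these
    two flows have the same total, so d is balanced and its support is closed
    under transitions.  If p and p' differed, both d and the negative part
    would charge [o], which is absurd. *)
Section Uniqueness.
Local Open Scope classical_set_scope.
Variables (R : realType) (T : choiceType) (Q : T -> T -> R) (o : T).
Variables (tot : T -> R) (C : R).
Hypotheses (Q_ge0 : forall x y, 0 <= Q x y) (Q_diag : forall x, Q x x = 0).
Hypothesis totE : forall (c : R) x, 0 <= c ->
  (\esum_(y in [set: T]) (c * Q x y)%:E = (c * tot x)%:E)%E.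
Hypothesis tot_le : forall x, tot x <= C.
Hypothesis reach : forall S : T -> Prop,
  (forall x y, S x -> 0 < Q x y -> S y) -> forall x, S x -> S o.

Lemma stationary_balance p x : stationary Q p ->
  ((p x * tot x)%:E = \esum_(y in [set: T]) (p y * Q y x)%:E)%E.
Proof.
move=> [p0 _ /(_ x)]; rewrite !esum_setC1 ?Q_diag ?mulr0 // => <-.
by rewrite totE.
Qed.

Lemma stationary_excess_closed p p' : stationary Q p -> stationary Q p' ->
  forall x y, p' x < p x -> 0 < Q x y -> p' y < p y.
Proof.
move=> sp sp'; pose r x := Num.min (p x) (p' x); pose d x := p x - r x.
have [p0 p1 _] := sp; have [p'0 _ _] := sp'.
have tot_ge0 x : 0 <= tot x.
  rewrite -lee_fin -[tot x]mul1r -totE //; apply: esum_ge0 => y _.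
  by rewrite lee_fin mul1r.
have r0 x : 0 <= r x by rewrite le_min p0 p'0.
have d0 x : 0 <= d x by rewrite subr_ge0 ge_min lexx.
have dQ0 x y : 0 <= d x * Q x y by rewrite mulr_ge0.
pose inflow x := (\esum_(y in [set: T]) (d y * Q y x)%:E)%E.
have inflow_ge x : ((d x * tot x)%:E <= inflow x)%E.
  have [pp'|p'p] := leP (p x) (p' x).
    rewrite (_ : d x = 0) ?mul0r; first by apply: esum_ge0 => y _; rewrite lee_fin.
    by rewrite /d /r (min_idPl pp') subrr.
  have -> : d x * tot x = p x * tot x - p' x * tot x.
    by rewrite /d /r (min_idPr (ltW p'p)) mulrBl.
  rewrite EFinB leeBlDr // !stationary_balance // -esumD => [|y _|y _]; last first.
  - by rewrite lee_fin mulr_ge0.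
  - by rewrite lee_fin.
  apply: le_esum => y _; rewrite -EFinD lee_fin -mulrDl ler_wpM2r //.
  by rewrite /d -lerBlDl opprB addrCA subrr addr0 ge_min lexx orbT.
have inflow_sum : (\esum_(x in [set: T]) inflow x =
                   \esum_(x in [set: T]) (d x * tot x)%:E)%E.
  rewrite esum_swap => [|x y]; last by rewrite lee_fin.
  by apply: eq_esum => y _; rewrite totE.
have fin : (\esum_(x in [set: T]) (d x * tot x)%:E < +oo)%E.
  have [x0|/forallNP noT] := pselect (exists x : T, True); last first.
    by rewrite esum1 // => x; have := noT x.
  have C0 : 0 <= C by have [x _] := x0; exact: le_trans (tot_le x).
  pose n := (Num.trunc C).+1.
  apply: (@le_lt_trans _ _ (\esum_(x in [set: T]) (\sum_(i <- iota 0 n) (p x)%:E)%E)%E).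
    apply: le_esum => x _; rewrite sumEFin lee_fin.
    rewrite big_const_seq count_predT size_iota iter_addr_0 -mulr_natr.
    apply: ler_pM => //; first by rewrite gerBl.
    by apply: le_trans (tot_le x) _; rewrite ltW // truncnS_gt.
  have -> : (\esum_(x in [set: T]) (\sum_(i <- iota 0 n) (p x)%:E)%E =
             (\sum_(i <- iota 0 n) \esum_(x in [set: T]) (p x)%:E)%E)%E.
    by apply: esum_sum => x i _ _; rewrite lee_fin.
  by rewrite p1 sumEFin ltry.
have E := esum_le_eq (fun x => introT andP (conj _ (inflow_ge x))) inflow_sum fin.
move=> x y p'p Qxy.
have dx : 0 < d x by rewrite /d subr_gt0 gt_min p'p orbT.
have : 0 < d y * tot y.
  rewrite -lte_fin (congr1 (@^~ y) (E _)); last by move=> ?; rewrite lee_fin mulr_ge0.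
  apply: (@lt_le_trans _ _ (d x * Q x y)%:E); first by rewrite lte_fin mulr_gt0.
  by apply: (@esum_ge1 _ _ (fun z => (d z * Q z y)%:E)) => z; rewrite lee_fin.
rewrite lt_neqAle eq_sym mulf_eq0 negb_or => /andP[/andP[dy _] _].
move: dy; rewrite /d /r; case: (leP (p y) (p' y)) => // _; by rewrite subrr eqxx.
Qed.

Lemma stationary_unique p p' : stationary Q p -> stationary Q p' -> p = p'.
Proof.
move=> sp sp'; have [p0 p1 _] := sp; have [p'0 p'1 _] := sp'.
have le_eq (f g : T -> R) : (forall x, 0 <= f x) ->
    (\esum_(x in [set: T]) (f x)%:E = 1)%E ->
    (\esum_(x in [set: T]) (g x)%:E = 1)%E -> (forall x, f x <= g x) -> f = g.
  move=> f0 f1 g1 fg.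
  have E : EFin \o f = EFin \o g; last first.
    by apply/funext => x; have [] := congr1 (@^~ x) E.
  apply: esum_le_eq => [x||]; rewrite /= ?f1 ?g1 ?ltry //.
  by rewrite !lee_fin f0 fg.
have [/existsNP[x /negP]|/contrapT all] := pselect (~ forall x, p x <= p' x).
  rewrite -ltNge => xp.
  have [/existsNP[y /negP]|/contrapT all] := pselect (~ forall x, p' x <= p x).
    rewrite -ltNge => yp.
    have := reach (stationary_excess_closed sp sp') xp.
    have := reach (stationary_excess_closed sp' sp) yp.
    by move=> /lt_trans /[apply]; rewrite ltxx.
  by apply/esym/le_eq.
exact: le_eq.
Qed.

End Uniqueness.

(** * The law of the finite system *)

Section JsqLaw.
Local Open Scope classical_set_scope.
Variables (R : realType) (N : nat) (lambda lambda_s mu q : R).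
Hypothesis N_gt0 : (0 < N)%N.
Local Notation beta := (lambda * q).
Hypotheses (beta_ge0 : 0 <= beta) (lambda_s_gt0 : 0 < lambda_s) (mu_gt0 : 0 < mu).
Implicit Types (x : state N) (i : 'I_N) (f g : state N -> R).

Local Notation smart := (@smart_rate R lambda_s N).
Local Notation gen := (@gen R N beta lambda_s mu).
Local Notation Q := (@jsq_rate R lambda lambda_s mu N q).

Let ls_ge0 := ltW lambda_s_gt0.
Let mu_ge0 := ltW mu_gt0.

Lemma arrival_ge0 x i : 0 <= beta + smart x i.
Proof. by rewrite addr_ge0 ?smart_rate_ge0. Qed.

Lemma jsq_rate_ge0 x y : 0 <= Q x y.
Proof.
by apply: sumr_ge0 => i _; rewrite addr_ge0 // mulr_ge0 // arrival_ge0.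
Qed.

Lemma jsq_rate_diag x : Q x x = 0.
Proof.
apply: big1 => i _; rewrite eq_sym (negPf (arrive_neq _ _)) mulr0 add0r.
case: (ltnP 0 (x i)) => [xi|_]; last by rewrite mulr0.
by rewrite eq_sym (negPf (depart_neq xi)) mulr0.
Qed.

Lemma jsq_rate_depart x i : (0 < x i)%N -> 0 < Q x (depart x i).
Proof.
move=> xi; rewrite /jsq_rate (bigD1 i) //= xi eqxx mulr1.
rewrite ltr_pwDl // ?ltr_wpDl ?mulr_ge0 ?arrival_ge0 // sumr_ge0 // => j _.
by rewrite addr_ge0 // mulr_ge0 ?arrival_ge0.
Qed.

Definition exit_rate x : R :=
  \sum_(i < N) (beta + smart x i + mu * (0 < x i)%N%:R).

Lemma exit_rate_le x : exit_rate x <= clock N beta lambda_s mu.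
Proof.
rewrite -(sum_rates beta lambda_s mu N_gt0 x); apply: ler_sum => i _.
by rewrite lerD2l ler_piMr // lern1 leq_b1.
Qed.

Lemma esum_jsq_rate c x : 0 <= c ->
  (\esum_(y in [set: state N]) (c * Q x y)%:E = (c * exit_rate x)%:E)%E.
Proof.
move=> c0.
pose a y i : R := c * (beta + smart x i) * (y == arrive x i)%:R.
pose d y i : R := c * (mu * (0 < x i)%N%:R) * (y == depart x i)%:R.
have a0 y i : (0 <= (a y i)%:E)%E by rewrite lee_fin !mulr_ge0 ?arrival_ge0.
have d0 y i : (0 <= (d y i)%:E)%E by rewrite lee_fin !mulr_ge0.
transitivity (\esum_(y in [set: state N])
    (\sum_(i < N) ((a y i)%:E + (d y i)%:E))%E)%E.
  apply: eq_esum => y _; rewrite mulr_sumr -sumEFin; apply: eq_bigr => i _.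
  rewrite -EFinD; congr EFin; rewrite /a /d -mulnb natrM; ring.
rewrite esum_sum => [|y i _ _]; last by rewrite adde_ge0.
rewrite mulr_sumr -sumEFin; apply: eq_bigr => i _.
rewrite esumD // /a /d.
rewrite !(esum_delta (c := fun=> _)) ?mulr_ge0 ?arrival_ge0 //.
by rewrite -EFinD -mulrDr.
Qed.

(** Departures alone lead from any state to the empty one. *)
Lemma jsq_reach (S : state N -> Prop) :
  (forall x y, S x -> 0 < Q x y -> S y) -> forall x, S x -> S (origin N).
Proof.
move=> SQ x; have [n] := ubnP (total_length x); elim: n x => // n IH x /ltnSE xn Sx.
have [/existsP[i xi]|/existsPn x0] := boolP [exists i, 0 < x i]%N.
  apply: IH (SQ _ _ Sx (jsq_rate_depart xi)); apply: leq_trans xn.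
  rewrite /total_length (bigD1 i) //= [X in (_ < X)%N](bigD1 i) //= departE eqxx subn1.
  rewrite -addSn prednK // leq_add2l leq_sum // => j _.
  by rewrite departE leq_subr.
rewrite (_ : origin N = x) //; apply/ffunP => i; rewrite ffunE.
by have := x0 i; rewrite -eqn0Ngt => /eqP.
Qed.

Lemma jsq_stationary_unique p p' : stationary Q p -> stationary Q p' -> p = p'.
Proof.
exact: (stationary_unique jsq_rate_ge0 jsq_rate_diag esum_jsq_rate
  exit_rate_le jsq_reach).
Qed.

Lemma gen_indic x y : gen (fun z => (z == x)%:R) y =
  Q y x + - exit_rate x * (y == x)%:R.
Proof.
rewrite mulNr; have [->|yx] := eqVneq y x.
  rewrite jsq_rate_diag mulr1 add0r -sumrN; apply: eq_bigr => i _.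
  rewrite (negPf (arrive_neq _ _)) sub0r eqxx.
  case: (posnP (x i)) => [/depart0 ->|xi]; first by rewrite eqxx /=; ring.
  by rewrite (negPf (depart_neq xi)) /=; ring.
rewrite mulr0 subr0; apply: eq_bigr => i _; rewrite (negPf yx) !subr0.
congr (_ * _ + _ * _); rewrite eq_sym //.
case: (posnP (y i)) => [/depart0 ->|//]; by rewrite eq_sym (negPf yx).
Qed.

Section Law.
Variable A : (state N -> R) -> R.
Hypothesis mA : invariant_mean beta lambda_s mu A.

Definition law x : R := A (fun y => (y == x)%:R).

Lemma mean_finite (F : {fset state N}) f :
  A (fun x => (x \in F)%:R * f x) = \sum_(y <- F) law y * f y.
Proof.
transitivity (A (fun x => \sum_(y <- F) f y * (x == y)%:R)).
  congr A; apply/funext => x; have [xF|xF] := boolP (x \in F).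
    rewrite (big_fsetD1 x) //= eqxx mulr1 mul1r big_seq big1 ?addr0 // => y.
    by rewrite !inE eq_sym => /andP[/negPf -> _]; rewrite mulr0.
  rewrite mul0r big_seq big1 // => y yF; case: eqP => [xy|]; rewrite ?mulr0 //.
  by move: xF; rewrite xy yF.
rewrite (mean_sum mA) => [|y]; last exact: boundedZ.
by apply: eq_bigr => y _; rewrite (meanZ mA) // mulrC.
Qed.

Lemma finite_total k : finite_set [set x : state N | (total_length x < k)%N].
Proof.
apply: (@sub_finite_set _ _
   ((fun g : {ffun 'I_N -> 'I_k} => [ffun i => val (g i)] : state N) @` setT)).
  move=> x /= xk; have xik i : (x i < k)%N.
    by apply: leq_ltn_trans xk; rewrite /total_length (bigD1 i) //= leq_addr.
  exists [ffun i => Ordinal (xik i)] => //.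
  by apply/ffunP => i; rewrite !ffunE.
exact/finite_image/finite_finset.
Qed.

(** Since no mass escapes, the mean is integration against the law. *)
Lemma esum_law f : bounded f -> (forall x, 0 <= f x) ->
  (\esum_(x in [set: state N]) (law x * f x)%:E = (A f)%:E)%E.
Proof.
move=> bf f0; have bF (F : {fset state N}) : bounded (fun x => (x \in F)%:R * f x).
  exact: boundedM.
apply/eqP; rewrite eq_le; apply/andP; split.
  apply: ge_ereal_sup => _ [X [finX _] <-].
  rewrite fsbig_finite //= sumEFin lee_fin -mean_finite.
  apply: (mean_le mA) => // x.
  by case: (x \in _); rewrite ?mul1r ?mul0r.
apply/lee_addgt0Pr => eps eps0.
have [M fM] := bf; pose M' := Num.max 1 M.
have M'0 : 0 < M' by rewrite lt_max ltr01.
have [|k Ak] := mean_tight mA (eps := eps / M'); first by rewrite divr_gt0.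
pose F := fset_set [set x : state N | (total_length x < k)%N].
have FE x : (x \in F) = (total_length x < k)%N.
  by rewrite in_fset_set; [apply/idP/idP; rewrite in_setE|exact: finite_total].
apply: (@le_trans _ _ ((\sum_(x <- F) law x * f x)%:E + eps%:E)%E); last first.
  rewrite leeD2r // -sumEFin; apply: esum_ge; exists [set` F].
    by split => //; exact: finite_fset.
  by rewrite fsbig_finite ?set_fsetK //; exact: finite_fset.
rewrite -EFinD lee_fin -mean_finite.
have eps_ge : M' * A (fun x => (k <= total_length x)%N%:R) <= eps.
  by rewrite mulrC -ler_pdivlMr.
apply: le_trans (lerD (lexx _) eps_ge); rewrite -(meanZ mA) // -(meanD mA) //;
  last exact: boundedZ.
apply: (mean_le mA) => //.
  by apply: boundedD => //; exact: boundedZ.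
move=> x /=; rewrite FE; case: ltnP => _; first by rewrite mul1r mulr0 addr0.
rewrite mul0r add0r mulr1 le_max; apply/orP; right.
by apply: le_trans (fM x); exact: ler_norm.
Qed.

Lemma bounded_jsq_rate y : bounded (fun x => Q x y).
Proof.
exists (clock N beta lambda_s mu) => x; rewrite ger0_norm ?jsq_rate_ge0 //.
apply: le_trans (exit_rate_le x); rewrite -lee_fin -[exit_rate x]mul1r.
rewrite -esum_jsq_rate // -[Q x y]mul1r.
apply: (@esum_ge1 _ _ (fun z => (1 * Q x z)%:E)) => z.
by rewrite lee_fin mul1r jsq_rate_ge0.
Qed.

Lemma law_stationary : stationary Q law.
Proof.
split=> [x||x]; first exact: (mean_ge0 mA).
  rewrite -(mean1 mA) -esum_law //; apply: eq_esum => x _.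
  by rewrite mulr1.
rewrite !esum_setC1 ?jsq_rate_diag ?mulr0 //.
rewrite (esum_law (bounded_jsq_rate x)) => [|y]; last exact: jsq_rate_ge0.
rewrite esum_jsq_rate; last exact: (mean_ge0 mA).
congr EFin; apply/esym/eqP.
rewrite -subr_eq0 mulrC -mulNr -(meanZ mA) // -(meanD mA) //; last 2 first.
  exact: bounded_jsq_rate.
  exact: boundedZ.
rewrite -[X in X == _](_ : A (gen (fun z => (z == x)%:R)) = _).
  by rewrite (mean_gen mA).
by congr A; apply/funext => y; rewrite gen_indic.
Qed.

Lemma jsq_lawE : jsq_law lambda lambda_s mu q = law.
Proof.
apply: jsq_stationary_unique law_stationary; apply: xgetPex.
by exists law; exact: law_stationary.
Qed.

Lemma bounded_min_length i K : bounded (fun x => (minn (x i) K)%:R : R).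
Proof. by exists K%:R => x; rewrite normr_nat ler_nat geq_minr. Qed.

(** The length of a queue is unbounded, so its mean is reached through the
    truncations. *)
Lemma mean_length_ge i K :
  ((A (fun x => (minn (x i) K)%:R))%:E <= jsq_mean_length lambda lambda_s mu q i)%E.
Proof.
rewrite -esum_law => [|| x]; [|exact: bounded_min_length|by []].
rewrite /jsq_mean_length jsq_lawE; apply: le_esum => x _.
by rewrite lee_fin ler_wpM2l ?(mean_ge0 mA) // ler_nat geq_minl.
Qed.

Lemma mean_length_le i B :
  (forall K, A (fun x => (minn (x i) K)%:R) <= B) ->
  (jsq_mean_length lambda lambda_s mu q i <= B%:E)%E.
Proof.
move=> AB; rewrite /jsq_mean_length jsq_lawE.
apply: ge_ereal_sup => _ [X [finX _] <-]; rewrite fsbig_finite //=.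
pose K := \max_(x <- fset_set X) x i.
apply: le_trans (_ : (A (fun x => (minn (x i) K)%:R))%:E <= _)%E; last first.
  by rewrite lee_fin.
rewrite -esum_law => [|| x]; [|exact: bounded_min_length|by []].
apply: esum_ge; exists X => //; rewrite fsbig_finite //= big_seq [leRHS]big_seq.
rewrite lee_sum // => x xX; rewrite lee_fin ler_wpM2l ?(mean_ge0 mA) // ler_nat.
by rewrite leq_min leqnn /= (@leq_bigmax_seq _ _ xpredT (fun x : state N => x i)).
Qed.

End Law.
End JsqLaw.

(** * A potential for the occupancies *)

Section Huber.
Variables (R : realFieldType) (a : R).
Hypothesis a_ge0 : 0 <= a.

Definition clamp (d : R) : R := Num.min a (Num.max 0 d).

(** The primitive of [clamp] that vanishes on negative numbers, written as the
    maximum over y in [0, a] of y d - y^2 / 2; see [huber_sup]. *)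
Definition huber (d : R) : R := clamp d * d - clamp d ^+ 2 / 2.

Lemma clamp_ge0 d : 0 <= clamp d.
Proof. by rewrite le_min a_ge0 le_max lexx. Qed.

Lemma clamp_le d : clamp d <= a.
Proof. by rewrite ge_min lexx. Qed.

Lemma clamp_max : clamp a = a.
Proof. by rewrite /clamp (max_idPr a_ge0) minxx. Qed.

(** [clamp] is the projection onto the interval from 0 to [a]: this is its
    variational characterization, from which convexity and smoothness of
    [huber] follow. *)
Lemma clamp_proj d y : 0 <= y <= a -> (d - clamp d) * (y - clamp d) <= 0.
Proof.
move=> /andP[y0 ya]; rewrite /clamp.
have [d0|d0] := leP d 0; first by rewrite (min_idPr a_ge0); nra.
by have [ad|da] := leP a d; nra.
Qed.

Lemma huber_sup d y : 0 <= y <= a -> y * d - y ^+ 2 / 2 <= huber d.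
Proof.
move=> /[dup] /andP[y0 ya] /(clamp_proj d) H; rewrite /huber -subr_ge0.
have := sqr_ge0 (y - clamp d); nra.
Qed.

Lemma huber_ge0 d : 0 <= huber d.
Proof.
by have := @huber_sup d 0; rewrite lexx a_ge0 mul0r expr0n mul0r subr0; apply.
Qed.

Lemma huber_convex d d' : clamp d * (d' - d) <= huber d' - huber d.
Proof.
have := @huber_sup d' (clamp d); rewrite clamp_ge0 clamp_le => /(_ isT).
by rewrite /huber; nra.
Qed.

Lemma huber_smooth d d' :
  huber d' - huber d <= clamp d * (d' - d) + (d' - d) ^+ 2 / 2.
Proof.
have := @clamp_proj d (clamp d'); rewrite clamp_ge0 clamp_le => /(_ isT).
rewrite /huber; have := sqr_ge0 (d' - d - (clamp d' - clamp d)); nra.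
Qed.

Lemma huber0 : huber 0 = 0.
Proof. by rewrite /huber /clamp maxxx (min_idPr a_ge0) mulr0 expr0n mul0r subr0. Qed.

Lemma huber_max : huber a = a ^+ 2 / 2.
Proof. by rewrite /huber clamp_max; field. Qed.

Lemma huber_le d u : d <= u -> 0 <= u -> huber d <= a * u.
Proof.
move=> du u0; have c0 := clamp_ge0 d; have ca := clamp_le d.
rewrite /huber; have := sqr_ge0 (clamp d); nra.
Qed.

End Huber.

Section Occupancy.
Variables (R : realType) (N : nat) (beta lambda_s mu : R).
Hypothesis N_gt0 : (0 < N)%N.
Hypotheses (beta_ge0 : 0 <= beta) (lambda_s_gt0 : 0 < lambda_s) (mu_gt0 : 0 < mu).
Hypothesis stable : beta + lambda_s < mu.
Implicit Types (x : state N) (i : 'I_N).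

Local Notation smart := (@smart_rate R lambda_s N).
Local Notation gen := (@gen R N beta lambda_s mu).
Local Notation rho := ((beta + lambda_s) / mu).
Local Notation sigma := (beta / mu).

Let N_neq0 : N%:R != 0 :> R. Proof. by rewrite pnatr_eq0 -lt0n. Qed.
Let mu_neq0 : mu != 0. Proof. exact: lt0r_neq0. Qed.

Definition occ k x : R := \sum_(i < N) N%:R^-1 * (k <= x i)%N%:R.

Lemma occ0 x : occ 0 x = 1.
Proof.
rewrite /occ (eq_bigr (fun=> N%:R^-1)) => [|i _]; last by rewrite mulr1.
by rewrite sumr_const card_ord -[LHS]mulr_natl divff.
Qed.

Lemma occ_ge0 k x : 0 <= occ k x.
Proof. by apply: sumr_ge0 => i _; rewrite mulr_ge0 // invr_ge0. Qed.

Lemma occ_le1 k x : occ k x <= 1.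
Proof.
rewrite -(occ0 x); apply: ler_sum => i _.
by rewrite ler_wpM2l ?invr_ge0 // ler_nat leq_b1.
Qed.

Lemma bounded_occ k : bounded (occ k).
Proof. by exists 1 => x; rewrite ger0_norm ?occ_ge0 ?occ_le1. Qed.

Lemma minlen_le_occ k x : (k <= minlen x)%N%:R <= occ k x.
Proof.
case: leqP => [km|_]; last exact: occ_ge0.
rewrite -(occ0 x); apply: ler_sum => i _.
by rewrite (leq_trans km (minlen_le N_gt0 _ _)).
Qed.

Lemma occ_le_total k x : occ k x <= (k <= total_length x)%N%:R.
Proof.
case: leqP => [kt|tk]; first exact: occ_le1.
rewrite /occ big1 // => i _.
have -> : (k <= x i)%N = false; last by rewrite mulr0.
apply/negbTE; rewrite -ltnNge; apply: leq_ltn_trans tk.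
by rewrite /total_length (bigD1 i) //= leq_addr.
Qed.

Lemma occ_arrive k x i :
  occ k.+1 (arrive x i) - occ k.+1 x = N%:R^-1 * (x i == k)%:R.
Proof.
rewrite /occ -sumrB (bigD1 i) //= big1 ?addr0 => [|j /negPf ji]; last first.
  by rewrite arriveE ji addn0 subrr.
rewrite -mulrBr arriveE eqxx addn1 ltnS; congr (_ * _).
by case: ltngtP => _; rewrite ?subrr ?subr0.
Qed.

Lemma occ_depart k x i :
  occ k.+1 (depart x i) - occ k.+1 x = - (N%:R^-1 * (x i == k.+1)%:R).
Proof.
rewrite /occ -sumrB (bigD1 i) //= big1 ?addr0 => [|j /negPf ji]; last first.
  by rewrite departE ji subn0 subrr.
rewrite -mulrBr departE eqxx subn1 -mulrN; congr (_ * _).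
rewrite -ltnS; case: (x i) => [|n] /=; first by rewrite subrr oppr0.
by rewrite eqSS !ltnS; case: ltngtP => _; rewrite ?subrr ?sub0r ?oppr0.
Qed.

Lemma occ_diff k x : occ k x - occ k.+1 x = \sum_(i < N) N%:R^-1 * (x i == k)%:R.
Proof.
rewrite /occ -sumrB; apply: eq_bigr => i _; rewrite -mulrBr; congr (_ * _).
by case: ltngtP => _; rewrite ?subrr ?subr0.
Qed.

Lemma gen_occ k x : gen (occ k.+1) x =
  beta * (occ k x - occ k.+1 x) + lambda_s * (minlen x == k)%:R
  - mu * (occ k.+1 x - occ k.+2 x).
Proof.
have -> : lambda_s * (minlen x == k)%:R =
    \sum_(i < N) smart x i * (N%:R^-1 * (x i == k)%:R).
  rewrite (sum_smart_rate N_gt0 lambda_s x (fun n => N%:R^-1 * (n == k)%:R)).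
  by rewrite mulrACA divff ?mul1r.
rewrite !occ_diff !mulr_sumr -big_split -sumrB; apply: eq_bigr => i _ /=.
by rewrite occ_arrive occ_depart; ring.
Qed.

(** The mean field probability of at least [k] customers. *)
Definition prof k : R := if k is j.+1 then rho * sigma ^+ j else 1.

Definition dev k x : R := occ k x - prof k.

Definition potential K x : R := \sum_(k < K) huber (1 - rho) (dev k.+1 x).

Let rho_lt1 : 0 <= 1 - rho.
Proof. by rewrite subr_ge0 ler_pdivrMr // mul1r ltW. Qed.

Lemma prof_balance k :
  beta * (prof k - prof k.+1) + lambda_s * (0%N == k)%:R
  = mu * (prof k.+1 - prof k.+2).
Proof. by case: k => [|k] /=; rewrite ?exprS ?expr0; field. Qed.

(** Subtracting the balance equation of the mean field leaves a linear system
    for the deviations, driven by the smart customers only through the level at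
    which they join. *)
Lemma gen_dev k x : gen (occ k.+1) x =
  beta * (dev k x - dev k.+1 x) + mu * (dev k.+2 x - dev k.+1 x) +
  lambda_s * ((minlen x == k)%:R - (0%N == k)%:R).
Proof. by rewrite gen_occ; have := prof_balance k; rewrite /dev; lra. Qed.

Lemma sum_delta_le1 K (n : nat) : \sum_(k < K) (n == k)%:R <= 1 :> R.
Proof.
case: (ltnP n K) => nK; last first.
  by rewrite big1 ?ler01 // => k _; rewrite eqn_leq leqNgt (leq_trans (ltn_ord k) nK).
rewrite (bigD1 (Ordinal nK)) //= eqxx big1 ?addr0 // => k /negPf kn.
by rewrite eq_sym -[n]/(val (Ordinal nK)) val_eqE kn.
Qed.

(** Chain rule up to second order: an arrival or a departure changes one
    occupancy only, by 1 / N, and the jumps have total rate of order N, so the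
    second order terms are of order 1 / N. *)
Lemma gen_potential_chain K x :
  gen (potential K) x <=
  \sum_(k < K) clamp (1 - rho) (dev k.+1 x) * gen (occ k.+1) x +
  (beta + lambda_s + mu) / (2 * N%:R).
Proof.
set e : R := N%:R^-1; set c := clamp (1 - rho).
have e0 : 0 <= e by rewrite invr_ge0.
have s0 i : 0 <= beta + smart x i.
  by rewrite addr_ge0 ?smart_rate_ge0 // ltW.
have up i : potential K (arrive x i) - potential K x <=
    \sum_(k < K) c (dev k.+1 x) * (e * (x i == k)%:R) + e ^+ 2 / 2.
  rewrite /potential -sumrB.
  apply: le_trans (_ : _ <= \sum_(k < K) (c (dev k.+1 x) * (e * (x i == k)%:R)
    + e ^+ 2 / 2 * (x i == k)%:R)) _.
    apply: ler_sum => k _; apply: le_trans (huber_smooth rho_lt1 _ _) _.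
    have -> : dev k.+1 (arrive x i) - dev k.+1 x = e * (x i == k)%:R.
      by rewrite -occ_arrive /dev; ring.
    by rewrite lerD2l; case: (_ == _); rewrite ?mulr1 ?mulr0 ?expr0n ?mul0r.
  rewrite big_split /= lerD2l -mulr_sumr ler_piMr ?sum_delta_le1 //.
  by rewrite divr_ge0 // sqr_ge0.
have down i : potential K (depart x i) - potential K x <=
    \sum_(k < K) c (dev k.+1 x) * - (e * (x i == k.+1)%:R) + e ^+ 2 / 2.
  rewrite /potential -sumrB.
  apply: le_trans (_ : _ <= \sum_(k < K) (c (dev k.+1 x) * - (e * (x i == k.+1)%:R)
    + e ^+ 2 / 2 * (x i == k.+1)%:R)) _.
    apply: ler_sum => k _; apply: le_trans (huber_smooth rho_lt1 _ _) _.
    have -> : dev k.+1 (depart x i) - dev k.+1 x = - (e * (x i == k.+1)%:R).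
      by rewrite -occ_depart /dev; ring.
    by rewrite lerD2l sqrrN; case: (_ == _); rewrite ?mulr1 ?mulr0 ?expr0n ?mul0r.
  rewrite big_split /= lerD2l -mulr_sumr ler_piMr ?divr_ge0 ?sqr_ge0 //.
  case: (x i) => [|n]; first by rewrite big1.
  exact: sum_delta_le1.
have -> : \sum_(k < K) c (dev k.+1 x) * gen (occ k.+1) x =
   \sum_(i < N) ((beta + smart x i) * \sum_(k < K) c (dev k.+1 x) * (e * (x i == k)%:R)
    + mu * \sum_(k < K) c (dev k.+1 x) * - (e * (x i == k.+1)%:R)).
  under eq_bigr => k _ do rewrite mulr_sumr.
  rewrite exchange_big; apply: eq_bigr => i _; rewrite !mulr_sumr -big_split.
  by apply: eq_bigr => k _ /=; rewrite occ_arrive occ_depart -/e; ring.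
have -> : (beta + lambda_s + mu) / (2 * N%:R) =
    \sum_(i < N) (beta + smart x i + mu) * (e ^+ 2 / 2).
  rewrite -mulr_suml (sum_rates _ _ _ N_gt0) /clock /e; field; exact: N_neq0.
rewrite -big_split; apply: ler_sum => i _ /=.
have := ler_wpM2l (s0 i) (up i); have := ler_wpM2l (ltW mu_gt0) (down i).
lra.
Qed.

(** The potential is cut off at level [K.+1] to be bounded; [occ K.+2] bounds
    the flow that enters from above the cut. *)
Lemma gen_potential K x :
  gen (potential K.+1) x <=
  mu * occ K.+2 x - mu * ((1 - rho) ^+ 2 / 2) * (1 <= minlen x)%N%:R +
  (beta + lambda_s + mu) / (2 * N%:R).
Proof.
apply: le_trans (gen_potential_chain _ _) _; rewrite lerD2r.
set h := huber (1 - rho); set c := clamp (1 - rho).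
have h0 d : 0 <= h d := huber_ge0 rho_lt1 d.
have dev0 : dev 0 x = 0 by rewrite /dev occ0 subrr.
(* once no queue is empty, the first deviation takes its largest value *)
have dev1 : (0 < minlen x)%N -> dev 1 x = 1 - rho.
  move=> m0; rewrite /dev /= expr0 mulr1; congr (_ - _).
  by apply/le_anti; rewrite occ_le1; have := minlen_le_occ 1 x; rewrite m0 => ->.
under eq_bigr => k _ do rewrite gen_dev.
have births : \sum_(k < K.+1) c (dev k.+1 x) * (beta * (dev k x - dev k.+1 x)) <= 0.
  apply: (@le_trans _ _ (beta * \sum_(k < K.+1) (h (dev k x) - h (dev k.+1 x)))).
    rewrite mulr_sumr; apply: ler_sum => k _; rewrite mulrCA ler_wpM2l //.
    exact: huber_convex.
  rewrite -(big_mkord xpredT (fun k => h (dev k x) - h (dev k.+1 x))).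
  rewrite (@telescope_sumr_eq _ _ _ (fun k => - h (dev k x))) => [||k _];
    [|by []|by rewrite opprK addrC].
  rewrite dev0 /h huber0 // opprK addr0.
  by rewrite mulrN oppr_le0 mulr_ge0 // huber_ge0.
have deaths : \sum_(k < K.+1) c (dev k.+1 x) * (mu * (dev k.+2 x - dev k.+1 x)) <=
    mu * (h (dev K.+2 x) - h (dev 1 x)).
  rewrite -(telescope_sumr (fun k => h (dev k.+1 x))) // mulr_sumr big_mkord.
  apply: ler_sum => k _; rewrite mulrCA ler_pM2l //; exact: huber_convex.
have smarts : \sum_(k < K.+1) c (dev k.+1 x) *
    (lambda_s * ((minlen x == k)%:R - (0%N == k)%:R)) <= 0.
  rewrite (eq_bigr (fun k : 'I_K.+1 => lambda_s * (c (dev k.+1 x) * (minlen x == k)%:R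
     - c (dev k.+1 x) * (0%N == k)%:R))); last by move=> k _; ring.
  rewrite -mulr_sumr sumrB pmulr_rle0 // subr_le0.
  have [->|m0] := posnP (minlen x); first by [].
  rewrite [leRHS]big_ord_recl /= mulr1 [X in _ <= _ + X]big1 ?addr0 => [|k _];
    last by rewrite mulr0.
  rewrite dev1 // /c clamp_max //.
  apply: le_trans (_ : (1 - rho) * \sum_(k < K.+1) (minlen x == k)%:R <= _).
    by rewrite mulr_sumr ler_sum // => k _; rewrite ler_wpM2r // clamp_le.
  by rewrite ler_piMr // sum_delta_le1.
have rho0 : 0 <= rho by rewrite divr_ge0 ?addr_ge0 // ltW.
have top : h (dev K.+2 x) <= occ K.+2 x.
  have du : dev K.+2 x <= occ K.+2 x.
    by rewrite gerBl mulr_ge0 // exprn_ge0 // divr_ge0 // ltW.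
  apply: le_trans (huber_le rho_lt1 du (occ_ge0 _ _)) _.
  by rewrite ler_piMl ?occ_ge0 // gerBl.
have bot : (1 - rho) ^+ 2 / 2 * (1 <= minlen x)%N%:R <= h (dev 1 x).
  case: ltnP => m0; last by rewrite mulr0.
  by rewrite dev1 // /h huber_max // mulr1.
have := ler_wpM2l (ltW mu_gt0) top; have := ler_wpM2l (ltW mu_gt0) bot.
have -> : \sum_(k < K.+1) c (dev k.+1 x) *
   (beta * (dev k x - dev k.+1 x) + mu * (dev k.+2 x - dev k.+1 x) +
    lambda_s * ((minlen x == k)%:R - (0%N == k)%:R)) =
  \sum_(k < K.+1) c (dev k.+1 x) * (beta * (dev k x - dev k.+1 x)) +
  \sum_(k < K.+1) c (dev k.+1 x) * (mu * (dev k.+2 x - dev k.+1 x)) +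
  \sum_(k < K.+1) c (dev k.+1 x) *
    (lambda_s * ((minlen x == k)%:R - (0%N == k)%:R)).
  by rewrite -!big_split; apply: eq_bigr => k _ /=; rewrite !mulrDr.
lra.
Qed.

End Occupancy.

(** * Stationary occupancies *)

Lemma sum_ltn_ord n K : (\sum_(k < K) (k < n) = minn n K)%N.
Proof.
elim: K => [|K IH]; first by rewrite minn0 big_ord0.
rewrite big_ord_recr /= IH.
case: (ltnP K n) => nK.
  by rewrite addn1 (minn_idPr nK).
by rewrite addn0 (minn_idPl (leqW nK)).
Qed.

Section StationaryOccupancy.
Variables (R : realType) (N : nat) (beta lambda_s mu : R).
Hypothesis N_gt0 : (0 < N)%N.
Hypotheses (beta_ge0 : 0 <= beta) (lambda_s_gt0 : 0 < lambda_s) (mu_gt0 : 0 < mu).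
Hypothesis stable : beta + lambda_s < mu.
Variable A : (state N -> R) -> R.
Hypothesis mA : invariant_mean beta lambda_s mu A.
Implicit Types (x : state N) (i : 'I_N).

Local Notation gen := (@gen R N beta lambda_s mu).
Local Notation occ := (@occ R N).
Local Notation rho := ((beta + lambda_s) / mu).
Local Notation sigma := (beta / mu).
Local Notation tau := (lambda_s / mu).

Definition tail k : R := A (occ k).
Definition min_tail k : R := A (fun x => (k <= minlen x)%N%:R).

Let rho_ge0 : 0 <= rho. Proof. by rewrite divr_ge0 ?addr_ge0 // ltW. Qed.
Let rho_lt1 : rho < 1. Proof. by rewrite ltr_pdivrMr // mul1r. Qed.
Let sigma_ge0 : 0 <= sigma. Proof. by rewrite divr_ge0 // ltW. Qed.
Let tau_ge0 : 0 <= tau. Proof. by rewrite divr_ge0 // ltW. Qed.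
Let rhoE : rho = sigma + tau. Proof. exact: mulrDl. Qed.

Lemma tail0 : tail 0 = 1.
Proof. by rewrite -(mean1 mA); congr A; apply/funext => x; rewrite occ0. Qed.

Lemma min_tail0 : min_tail 0 = 1.
Proof. by rewrite -(mean1 mA). Qed.

Lemma tail_ge0 k : 0 <= tail k.
Proof. by apply: (mean_ge0 mA); [exact: bounded_occ|exact: occ_ge0]. Qed.

Lemma min_tail_ge0 k : 0 <= min_tail k.
Proof. exact: (mean_ge0 mA). Qed.

Lemma min_tail_le k : min_tail k <= tail k.
Proof.
by apply: (mean_le mA) => // [|x]; [exact: bounded_occ|exact: minlen_le_occ].
Qed.

Lemma min_tail_le1 k : min_tail k.+1 <= min_tail 1.
Proof.
apply: (mean_le mA) => // x; rewrite ler_nat.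
by case: (ltnP k) => // km; rewrite (leq_trans _ km).
Qed.

Lemma tail_vanish eps : 0 < eps -> exists k0, forall k, (k0 <= k)%N -> tail k <= eps.
Proof.
move=> /(mean_tight mA)[k0 Ak0]; exists k0 => k k0k; apply: le_trans Ak0.
apply: (mean_le mA) => // [|x]; first exact: bounded_occ.
apply: le_trans (occ_le_total _ N_gt0 _ _) _; rewrite ler_nat.
by case: (leqP k) => // kt; rewrite (leq_trans k0k kt).
Qed.

(** The mean of the generator of [occ k.+1] is 0. *)
Lemma tail_shift k :
  mu * tail k.+1 - beta * tail k - lambda_s * min_tail k =
  mu * tail k.+2 - beta * tail k.+1 - lambda_s * min_tail k.+1.
Proof.
have bo := @bounded_occ R N N_gt0.
have := mean_gen mA (bo k.+1).
pose f1 x := beta * occ k x; pose f2 x := (- (beta + mu)) * occ k.+1 x.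
pose f3 x := mu * occ k.+2 x; pose f4 x := lambda_s * (k <= minlen x)%N%:R.
pose f5 x := (- lambda_s) * (k.+1 <= minlen x)%N%:R.
have -> : gen (occ k.+1) = (f1 \+ f2) \+ (f3 \+ (f4 \+ f5)).
  apply/funext => x; rewrite (gen_occ beta lambda_s mu N_gt0) /= /f1 /f2 /f3 /f4 /f5.
  have -> : (minlen x == k)%:R = (k <= minlen x)%N%:R - (k.+1 <= minlen x)%N%:R :> R.
    by case: ltngtP => _; rewrite ?subrr ?subr0.
  ring.
have b1 : bounded f1 by exact: boundedZ.
have b2 : bounded f2 by exact: boundedZ.
have b3 : bounded f3 by exact: boundedZ.
have b4 : bounded f4 by exact: boundedZ.
have b5 : bounded f5 by exact: boundedZ.
have b45 := boundedD b4 b5; have b345 := boundedD b3 b45; have b12 := boundedD b1 b2.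
rewrite !(meanD mA) // !(meanZ mA) // -!/(tail _) -!/(min_tail _).
lra.
Qed.

(** Flow balance between the levels [k] and [k.+1]: the imbalance does not
    depend on the level, and it vanishes at infinity. *)
Lemma tail_balance k : tail k.+1 = sigma * tail k + tau * min_tail k.
Proof.
pose c j := mu * tail j.+1 - beta * tail j - lambda_s * min_tail j.
have cE j : c (k + j)%N = c k.
  elim: j => [|j IH]; rewrite ?addn0 // addnS -IH; exact/esym/tail_shift.
suff c0 : c k = 0.
  apply: (mulfI (lt0r_neq0 mu_gt0)); move: c0; rewrite /c => c0.
  have -> : mu * (sigma * tail k + tau * min_tail k) =
            beta * tail k + lambda_s * min_tail k by field; exact: lt0r_neq0.
  lra.
apply/eqP; rewrite -normr_le0; apply/ler_addgt0Pr => eps eps0; rewrite add0r.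
have [k0 tk0] : exists k0, forall j, (k0 <= j)%N ->
    tail j <= eps / (mu + beta + lambda_s).
  by apply: tail_vanish; rewrite divr_gt0 // -addrA ltr_wpDr // addr_ge0 // ltW.
have D0 : 0 < mu + beta + lambda_s by rewrite -addrA ltr_wpDr // addr_ge0 // ltW.
rewrite -(cE k0) /c.
have t1 := tk0 (k + k0).+1 (leq_trans (leq_addl _ _) (leqnSn _)).
have t2 := tk0 (k + k0)%N (leq_addl _ _).
move: t1 t2; rewrite !ler_pdivlMr // => t1 t2.
have g1 := tail_ge0 (k + k0).+1; have g2 := tail_ge0 (k + k0).
have g3 := min_tail_ge0 (k + k0); have g4 := min_tail_le (k + k0).
have lg := lambda_s_gt0; have mg := mu_gt0; have bg := beta_ge0.
have L1 := ler_wpM2l (ltW lg) g4.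
have M1 := mulr_ge0 (ltW mg) g1; have M2 := mulr_ge0 bg g1.
have M3 := mulr_ge0 (ltW lg) g1; have M4 := mulr_ge0 (ltW mg) g2.
have M5 := mulr_ge0 bg g2; have M6 := mulr_ge0 (ltW lg) g2.
have M7 := mulr_ge0 (ltW lg) g3.
rewrite ler_norml; apply/andP; split; lra.
Qed.

(** As [min_tail k <= tail k], a queue is no longer than an isolated one that
    receives smart customers at rate [lambda_s] whatever its length. *)
Lemma tail_geometric k : tail k <= rho ^+ k.
Proof.
elim: k => [|k IH]; first by rewrite tail0.
rewrite tail_balance exprS; apply: le_trans (_ : rho * tail k <= _).
  by rewrite rhoE mulrDl lerD2l ler_wpM2l // min_tail_le.
by rewrite ler_wpM2l.
Qed.

Lemma tail_ge k : rho * sigma ^+ k <= tail k.+1.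
Proof.
elim: k => [|k IH]; first by rewrite tail_balance tail0 min_tail0 rhoE !mulr1.
rewrite tail_balance exprS mulrCA; apply: le_trans (ler_wpM2l sigma_ge0 IH) _.
by rewrite lerDl mulr_ge0 // min_tail_ge0.
Qed.

Local Notation busy_const := ((beta + lambda_s + mu) / (mu * (1 - rho) ^+ 2)).

(** The mean of [gen_potential], with the level of the cut going to infinity. *)
Lemma min_tail_bound : min_tail 1 <= busy_const / N%:R.
Proof.
have N0 : 0 < N%:R :> R by rewrite ltr0n.
have a0 : 0 < 1 - rho by rewrite subr_gt0.
pose D := (beta + lambda_s + mu) / (2 * N%:R).
apply/ler_addgt0Pr => eps eps0.
have [K tK] := tail_vanish (mulr_gt0 eps0 (divr_gt0 (exprn_gt0 2 a0) (ltr0Sn R 1))).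
have {}tK := tK K.+2 (leq_trans (leqnSn _) (leqnSn _)).
pose f1 x := mu * occ K.+2 x.
pose f2 x := (- (mu * ((1 - rho) ^+ 2 / 2))) * (1 <= minlen x)%N%:R.
have b1 : bounded f1 by apply: boundedZ; exact: bounded_occ.
have b2 : bounded f2 by exact: boundedZ.
have bP : bounded (@potential R N beta lambda_s mu K.+1).
  have a1 := ltW a0.
  apply: bounded_sum => k; exists (1 - rho) => x.
  have d1 : dev beta lambda_s mu k.+1 x <= 1.
    rewrite /dev lerBlDr (le_trans (occ_le1 _ N_gt0 _ _)) // lerDl.
    by rewrite mulr_ge0 // exprn_ge0.
  by rewrite ger0_norm ?huber_ge0 // -[leRHS]mulr1 huber_le.
have : A (gen (@potential R N beta lambda_s mu K.+1)) <=
       A ((f1 \+ f2) \+ (fun=> D)).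
  apply: (mean_le mA) => [||x].
  - exact: bounded_gen.
  - by do !apply: boundedD => //.
  - apply: le_trans (gen_potential N_gt0 beta_ge0 lambda_s_gt0 mu_gt0 stable _ _) _.
    by rewrite /= /f1 /f2 mulNr.
rewrite (mean_gen mA) // (meanD mA) //; last exact: boundedD.
rewrite (meanD mA) // !(meanZ mA) //; last exact: bounded_occ.
rewrite -/(tail _) -/(min_tail _) (mean_cst mA) => H.
have P : 0 < mu * ((1 - rho) ^+ 2 / 2) by rewrite mulr_gt0 // divr_gt0 // exprn_gt0.
rewrite -(ler_pM2l P) mulrDr.
have -> : mu * ((1 - rho) ^+ 2 / 2) * (busy_const / N%:R) = D.
  by rewrite /D; field; rewrite !gt_eqF ?subr_gt0 // ltr0n.
have := ler_wpM2l (ltW mu_gt0) tK; move: H.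
rewrite mulNr -/D.
lra.
Qed.

(** By symmetry a given queue is as long as an average one. *)
Lemma mean_min_length i K : A (fun x => (minn (x i) K)%:R) = \sum_(k < K) tail k.+1.
Proof.
have tailE k : A (fun x => (k <= x i)%N%:R) = tail k.
  rewrite /tail (_ : occ k = fun x => N%:R^-1 * \sum_(j < N) (k <= x j)%N%:R); last first.
    by apply/funext => x; rewrite mulr_sumr.
  rewrite (meanZ mA); last exact: bounded_sum.
  rewrite (mean_sum mA) // (eq_bigr (fun=> A (fun x => (k <= x i)%N%:R))).
    by rewrite sumr_const card_ord -[A _ *+ N]mulr_natl mulKf // pnatr_eq0 -lt0n.
  move=> j _; rewrite -(mean_permute mA (tperm i j)) //; congr A.
  by apply/funext => x /=; rewrite ffunE tpermR.
under eq_bigr => k _ do rewrite -tailE.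
rewrite -(mean_sum mA) => [|k]; last by [].
congr A; apply/funext => x; rewrite -natr_sum; congr _%:R.
exact/esym/sum_ltn_ord.
Qed.

Lemma sum_tail_ge K : rho / (1 - sigma) * (1 - sigma ^+ K) <= \sum_(k < K) tail k.+1.
Proof.
apply: le_trans (_ : \sum_(k < K) rho * sigma ^+ k <= _); last first.
  by apply: ler_sum => k _; exact: tail_ge.
have s1 : 1 - sigma != 0.
  by rewrite gt_eqF // subr_gt0 (le_lt_trans _ rho_lt1) // rhoE lerDl.
rewrite -mulr_sumr -mulrA ler_wpM2l // mulrC ler_pdivrMr; last first.
  by rewrite lt0r s1 subr_ge0 (le_trans _ (ltW rho_lt1)) // rhoE lerDl.
by rewrite -[leLHS]opprB subrX1 -mulNr opprB [leLHS]mulrC.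
Qed.

(** The first [J] levels are controlled by [min_tail_bound], the others by
    [tail_geometric]. *)
Lemma sum_tail_le J K : \sum_(k < K) tail k.+1 <=
  rho / (1 - sigma) +
  tau / (1 - sigma) * (J%:R * (busy_const / N%:R) + rho ^+ J / (1 - rho)).
Proof.
have s1 : 0 < 1 - sigma.
  by rewrite subr_gt0 (le_lt_trans _ rho_lt1) // rhoE lerDl.
have r1 : 0 < 1 - rho by rewrite subr_gt0.
have Ssum (f : nat -> R) : \sum_(k < K) f k + f K = f 0%N + \sum_(k < K) f k.+1.
  by rewrite -(big_mkord xpredT f) -big_nat_recr // big_nat_recl // big_mkord.
set B := \sum_(k < K) _; set T := \sum_(k < K) min_tail k.+1.
have BE : B = sigma * (1 + B - tail K) + tau * (1 + T - min_tail K).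
  have := Ssum tail; rewrite tail0 => /(canRL (addrK _)) <-.
  have := Ssum min_tail; rewrite min_tail0 => /(canRL (addrK _)) <-.
  rewrite !mulr_sumr -big_split.
  by apply: eq_bigr => k _ /=; exact: tail_balance.
have TB : T <= J%:R * (busy_const / N%:R) + rho ^+ J / (1 - rho).
  apply: le_trans (_ : \sum_(k < J + K) min_tail k.+1 <= _).
    rewrite addnC big_split_ord /= lerDl sumr_ge0 // => k _; exact: min_tail_ge0.
  rewrite big_split_ord /=; apply: lerD.
    rewrite -[J in J%:R]card_ord mulr_natl -sumr_const; apply: ler_sum => k _.
    exact: le_trans (min_tail_le1 _) min_tail_bound.
  apply: le_trans (_ : \sum_(k < K) rho ^+ J * rho ^+ k <= _).
    apply: ler_sum => k _; rewrite -exprD.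
    apply: le_trans (min_tail_le _) _; apply: le_trans (tail_geometric _) _.
    by rewrite exprS ler_piMl ?exprn_ge0 // ltW.
  rewrite -mulr_sumr ler_wpM2l ?exprn_ge0 // -[leRHS]mul1r ler_pdivlMr //.
  by rewrite [leLHS]mulrC -opprB mulNr -subrX1 opprB gerBl exprn_ge0.
have t0 := tail_ge0 K; have m0 := min_tail_ge0 K.
set X := J%:R * _ + _ in TB *.
have -> : rho / (1 - sigma) + tau / (1 - sigma) * X = (rho + tau * X) / (1 - sigma).
  by rewrite [RHS]mulrDl; congr (_ + _); exact: mulrAC.
rewrite ler_pdivlMr //.
have M1 := mulr_ge0 sigma_ge0 t0; have M2 := mulr_ge0 tau_ge0 m0.
have M3 := ler_wpM2l tau_ge0 TB.
rewrite rhoE; lra.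
Qed.

End StationaryOccupancy.

(** * Convergence of the mean length *)

Section Convergence.
Variables (R : realType).

Lemma expr_vanish (x eps : R) : 0 <= x -> x < 1 -> 0 < eps -> exists n, x ^+ n <= eps.
Proof.
move=> x0 x1 eps0; have xn : `|x| < 1 by rewrite ger0_norm.
have := cvg_geometric 1 xn => /cvgr0Pnorm_le /(_ _ eps0) [n _ Hn].
exists n; have := Hn n (leqnn n).
by rewrite /geometric /= mul1r ger0_norm // exprn_ge0.
Qed.

Lemma cvg_natmul_geometric (x : R) : 0 <= x -> x < 1 ->
  ((fun n => n.+1%:R * x ^+ n) @ \oo --> (0 : R))%classic.
Proof.
move=> x0 x1; pose r := Num.sqrt x.
have r0 : 0 <= r by exact: sqrtr_ge0.
have r1 : r < 1 by rewrite -[ltRHS]sqrtr1 ltr_sqrt.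
apply: (@squeeze_cvgr _ _ _ _ (fun=> 0) (geometric (1 - r)^-1 r)).
- apply: nearW => n; rewrite mulr_ge0 ?exprn_ge0 //=.
  (* each of the n + 1 copies of r^n is at most a term of a geometric sum *)
  rewrite -(sqr_sqrtr x0) -/r -exprM mulnC exprM expr2 mulrA ler_wpM2r ?exprn_ge0 //.
  rewrite -[leRHS]mul1r ler_pdivlMr ?subr_gt0 //.
  apply: le_trans (_ : (\sum_(i < n.+1) r ^+ i) * (1 - r) <= _).
    have -> : n.+1%:R * r ^+ n = \sum_(i < n.+1) r ^+ n.
      by rewrite sumr_const card_ord mulr_natl.
    rewrite ler_wpM2r ?subr_ge0 ?(ltW r1) //.
    apply: ler_sum => i _; apply: ler_wiXn2l => //; first exact: ltW.
    by rewrite -ltnS.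
  by rewrite mulrC -opprB mulNr -subrX1 opprB gerBl exprn_ge0.
- exact: cvg_cst.
- by apply: cvg_geometric; rewrite ger0_norm.
Qed.

Section MeanFieldSojourn.
Variables (lambda lambda_s mu q : R).
Hypotheses (q_ge0 : 0 <= q) (lambda_gt0 : 0 < lambda) (lambda_s_gt0 : 0 < lambda_s).
Hypotheses (mu_gt0 : 0 < mu) (stable : lambda * q + lambda_s < mu).
Local Notation rho := ((lambda * q + lambda_s) / mu).
Local Notation sigma := (lambda * q / mu).

(** Closed form of the partial sums, whose correction terms vanish. *)
Lemma mf_mean_sojournE : mf_mean_sojourn lambda lambda_s mu q =
  (mu^-1 * (rho / (1 - sigma) + 1))%:E.
Proof.
have s0 : 0 <= sigma by rewrite divr_ge0 ?mulr_ge0 // ltW.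
have s1 : sigma < 1.
  by rewrite ltr_pdivrMr // mul1r (lt_trans _ stable) // ltrDl.
have d0 : 1 - sigma != 0 by rewrite gt_eqF // subr_gt0.
apply/cvg_lim => //; rewrite -(cvg_shiftS _).
have -> : [sequence (\sum_(0 <= k < n.+1)
      (k.+1%:R / mu * mf_law lambda lambda_s mu q k)%:E)%E]_n =
    EFin \o (fun n => mu^-1 * (rho / (1 - sigma) + 1) -
      mu^-1 * rho * ((1 - sigma)^-1 * sigma ^+ n + n.+1%:R * sigma ^+ n)).
  apply/funext => n /=; rewrite sumEFin; congr EFin.
  elim: n => [|n IH].
    rewrite big_nat1 /mf_law /mf_rho expr0. move: d0; set s := sigma => d0. field. 
    by rewrite d0 gt_eqF.
  rewrite big_nat_recr // IH /= /mf_rho /mf_sigma exprS -[n.+2%:R]natr1 -natr1.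
  move: d0; set s := sigma => d0; set p := s ^+ n. field.
  by rewrite d0 gt_eqF.
apply: cvg_EFin; first exact: nearW.
rewrite -[X in (_ --> X)%classic]subr0; apply: cvgB; first exact: cvg_cst.
rewrite -[X in (_ --> X)%classic](mulr0 (mu^-1 * rho)); apply: cvgMr.
rewrite -[X in (_ --> X)%classic]addr0; apply: cvgD.
  by apply: cvg_geometric; rewrite ger0_norm.
exact: cvg_natmul_geometric.
Qed.

End MeanFieldSojourn.

Section MeanLength.
Variables (N : nat) (lambda lambda_s mu q : R).
Hypotheses (N_gt0 : (0 < N)%N) (beta_ge0 : 0 <= lambda * q).
Hypotheses (lambda_s_gt0 : 0 < lambda_s) (mu_gt0 : 0 < mu).
Hypothesis stable : lambda * q + lambda_s < mu.
Local Notation rho := ((lambda * q + lambda_s) / mu).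
Local Notation sigma := (lambda * q / mu).
Local Notation tau := (lambda_s / mu).
Local Notation busy_const := ((lambda * q + lambda_s + mu) / (mu * (1 - rho) ^+ 2)).

(** The upper bound tends to the lower one when [J], then [N], go to
    infinity. *)
Lemma jsq_mean_length_bounds (J : nat) (i : 'I_N) : exists2 l : R,
  jsq_mean_length lambda lambda_s mu q i = l%:E &
  rho / (1 - sigma) <= l <= rho / (1 - sigma) +
    tau / (1 - sigma) * (J%:R * (busy_const / N%:R) + rho ^+ J / (1 - rho)).
Proof.
have [A mA] := invariant_mean_exists N_gt0 beta_ge0 lambda_s_gt0 mu_gt0 stable.
have Lge K := mean_length_ge N_gt0 beta_ge0 lambda_s_gt0 mu_gt0 mA i K.
pose U := rho / (1 - sigma) +
  tau / (1 - sigma) * (J%:R * (busy_const / N%:R) + rho ^+ J / (1 - rho)).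
have Lle : (jsq_mean_length lambda lambda_s mu q i <= U%:E)%E.
  apply: (mean_length_le N_gt0 beta_ge0 lambda_s_gt0 mu_gt0 mA) => K.
  rewrite (mean_min_length N_gt0 mA); exact: sum_tail_le.
have s0 : 0 <= sigma by rewrite divr_ge0 // ltW.
have s1 : sigma < 1 by rewrite ltr_pdivrMr // mul1r (lt_trans _ stable) // ltrDl.
have L0 : 0 <= rho / (1 - sigma).
  by rewrite !divr_ge0 ?subr_ge0 ?addr_ge0 // ltW.
have {}Lge : ((rho / (1 - sigma))%:E <= jsq_mean_length lambda lambda_s mu q i)%E.
  apply/lee_addgt0Pr => eps eps0.
  have [K sK] : exists K, sigma ^+ K <= eps / (rho / (1 - sigma) + 1).
    by apply: expr_vanish => //; rewrite divr_gt0 // ltr_wpDl.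
  apply: le_trans (leeD2r _ (Lge K)); rewrite -EFinD lee_fin (mean_min_length N_gt0 mA).
  have := sum_tail_ge N_gt0 beta_ge0 lambda_s_gt0 mu_gt0 stable mA K.
  move: sK; rewrite ler_pdivlMr ?ltr_wpDl //.
  have := exprn_ge0 K s0; nra.
have Lfin : jsq_mean_length lambda lambda_s mu q i \is a fin_num.
  by rewrite fin_real // (lt_le_trans _ Lge) ?ltNyr // (le_lt_trans Lle) // ltry.
exists (fine (jsq_mean_length lambda lambda_s mu q i)); first by rewrite fineK.
by rewrite -!lee_fin fineK // Lge Lle.
Qed.

End MeanLength.
End Convergence.

Theorem theorem4p3 (R : realType) (lambda lambda_s mu reward cost qe : R)
  (lambda_gt0 : 0 < lambda) (lambda_s_gt0 : 0 < lambda_s) (mu_gt0 : 0 < mu)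
  (reward_gt0 : 0 < reward) (cost_gt0 : 0 < cost)
  (stable : lambda + lambda_s < mu) (worthwhile : cost / mu <= reward)
  (qe_nash : mf_nash lambda lambda_s mu reward cost qe) :
  forall eps : R, 0 < eps ->
  exists N0 : nat, forall N : nat, (N0 < N)%N ->
    jsq_eps_nash lambda lambda_s mu reward cost N eps qe.
Proof.
move=> eps eps0; have [/andP[q0 q1] nash] := qe_nash.
have beta0 : 0 <= lambda * qe by rewrite mulr_ge0 // ltW.
have st : lambda * qe + lambda_s < mu.
  by apply: le_lt_trans stable; rewrite lerD2r ler_piMr // ltW.
set rho := (lambda * qe + lambda_s) / mu; set sigma := lambda * qe / mu.
set tau := lambda_s / mu.
set busy := (lambda * qe + lambda_s + mu) / (mu * (1 - rho) ^+ 2).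
have rho0 : 0 <= rho by rewrite divr_ge0 ?addr_ge0 // ltW.
have rho1 : rho < 1 by rewrite ltr_pdivrMr // mul1r.
have sigma1 : sigma < 1 by rewrite ltr_pdivrMr // mul1r (lt_trans _ st) // ltrDl.
have tau0 : 0 < tau by rewrite divr_gt0.
have busy0 : 0 <= busy.
  apply: divr_ge0; first by rewrite !addr_ge0 // ltW.
  by rewrite mulr_ge0 ?sqr_ge0 // ltW.
(* bound on each of the two error terms, the first one through the choice of N
   and the second one through the choice of J *)
pose eta := eps * mu / cost * ((1 - sigma) / tau) / 2.
have eta0 : 0 < eta by rewrite !(mulr_gt0, invr_gt0, subr_gt0).
have [J rhoJ] : exists J, rho ^+ J <= eta * (1 - rho).
  by apply: expr_vanish => //; rewrite mulr_gt0 // subr_gt0.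
exists (Num.trunc (J%:R * busy / eta)) => N N0N.
have N_gt0 : (0 < N)%N := leq_ltn_trans (leq0n _) N0N.
have JN : J%:R * (busy / N%:R) <= eta.
  rewrite mulrA ler_pdivrMr ?ltr0n // [leRHS]mulrC -ler_pdivrMr //.
  by apply: ltW; apply: lt_le_trans (truncnS_gt _) _; rewrite ler_nat.
have gap : tau / (1 - sigma) * (J%:R * (busy / N%:R) + rho ^+ J / (1 - rho)) <=
    eps * mu / cost.
  have rJ : rho ^+ J / (1 - rho) <= eta by rewrite ler_pdivrMr // subr_gt0.
  apply: le_trans (_ : tau / (1 - sigma) * (eta + eta) <= _).
    have c0 : 0 <= tau / (1 - sigma).
      by rewrite divr_ge0 ?subr_ge0 ?(ltW tau0) ?(ltW sigma1).
    by apply: (ler_wpM2l c0); exact: lerD.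
  rewrite (_ : _ * (eta + eta) = eps * mu / cost) // /eta; field.
  by rewrite !gt_eqF // subr_gt0.
split=> [|i r /andP[r0 r1]]; first by rewrite q0.
have [l lE /andP[l1 l2]] :=
  jsq_mean_length_bounds N_gt0 beta0 lambda_s_gt0 mu_gt0 st J i.
have := nash r; rewrite r0 r1 => /(_ isT).
rewrite /mf_utility (mf_mean_sojournE q0 lambda_gt0 lambda_s_gt0 mu_gt0 st).
rewrite /jsq_utility /jsq_mean_sojourn lE -/rho -/sigma.
rewrite -!(EFinM, EFinB, EFinD) !lee_fin.
set L := rho / (1 - sigma) in l1 l2 *.
have e0 : 0 <= cost / mu * (l - L) by rewrite mulr_ge0 ?divr_ge0 ?subr_ge0 // ltW.
have e1 : cost / mu * (l - L) <= eps.
  rewrite mulrC mulrA ler_pdivrMr // -ler_pdivlMr // lerBlDl.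
  by apply: le_trans l2 _; rewrite lerD2l.
have -> : reward - cost * (mu^-1 * (l + 1)) =
    reward - cost * (mu^-1 * (L + 1)) - cost / mu * (l - L) by ring.
set s := reward - _; set e := cost / mu * _ in e0 e1 *.
nra.
Qed.
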